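(* Let $\mathcal{A}:\mathbb{R}^{m\times n}\to\mathbb{R}^p$ be a linear map with adjoint $\mathcal{A}^*$, let $b\in\mathbb{R}^p$ with $\|\mathcal{A}^*b\|_2>0$, and let $\lambda^*>0$. Let $y(\lambda^* )$ be the optimal solution of $$\min_{y\in\mathbb{R}^p}\ \tfrac12\|y\|^2-b^Ty\quad\text{s.t. } (\lambda,\mathcal{A}^*y)\in\operatorname{epi}\|\cdot\|_2$$ with $\lambda=\lambda^*$. If $y(\lambda^* )$ is constraint nondegenerate for this problem, i.e., $$(0,\mathcal{A}^*\mathbb{R}^p)+\operatorname{lin}\left(T_{\operatorname{epi}\|\cdot\|_2}(\lambda^*,\mathcal{A}^*y(\lambda^* ))\right)=\mathbb{R}\times\mathbb{R}^{m\times n},$$ then the value function $\varphi(\cdot)$ is strongly semismooth at $\lambda^*$.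
   Context: For matrices, $\|\cdot\|_*$ is the nuclear norm and $\|\cdot\|_2$ the spectral norm; $\|\cdot\|$ is the Euclidean norm for vectors (Frobenius norm for matrices). $\operatorname{epi}\|\cdot\|_2:=\{(t,X)\in\mathbb{R}\times\mathbb{R}^{m\times n}\mid t\geqslant\|X\|_2\}$. For $\lambda>0$ the value function is $\varphi(\lambda):=\|\mathcal{A}X^*(\lambda)-b\|$, where $X^*(\lambda)$ is any optimal solution of $\min_{X\in\mathbb{R}^{m\times n}}\lambda\|X\|_*+\frac12\|\mathcal{A}X-b\|^2$ (the value does not depend on the choice of $X^*(\lambda)$); equivalently $\varphi(\lambda)=\|\Pi_{\lambda Q}(b)\|$, where $Q=\{z\in\mathbb{R}^p\mid\|\mathcal{A}^*z\|_2\leqslant1\}$ and $\Pi$ denotes Euclidean projection. For a closed convex set $K$ in a Euclidean space $\mathcal{Y}$ and $y\in K$, the tangent cone is $T_K(y):=\{d\in\mathcal{Y}\mid\operatorname{dist}(y+td,K)=o(t),\ t\geq0\}$; for a closed convex cone $D$, $\operatorname{lin}(D)=D\cap(-D)$. Here $(0,\mathcal{A}^*\mathbb{R}^p)=\{(0,\mathcal{A}^*y)\mid y\in\mathbb{R}^p\}$. For a locally Lipschitz function $F$ on an open set, $\partial_BF(x)$ is the set of limits of Jacobians $F'(x^k)$ along sequences $x^k\to x$ of differentiability points, and $\partial F(x):=\operatorname{conv}\partial_BF(x)$ (Clarke generalized Jacobian). $F$ is strongly G-semismooth at $x$ if for any $h\to0$ and $V\in\partial F(x+h)$, $F(x+h)-F(x)-Vh=O(\|h\|^2)$.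 $F$ is calmly B-differentiable at $x$ if the directional derivatives $F'(x;h):=\lim_{t\downarrow0}(F(x+th)-F(x))/t$ exist for all $h$ and $F(x+h)-F(x)-F'(x;h)=O(\|h\|^2)$ as $h\to0$. $F$ is strongly semismooth at $x$ if it is both strongly G-semismooth and calmly B-differentiable at $x$. *)

(* Defs.v *)
From HB Require Import structures.
From mathcomp Require Import all_boot all_order all_algebra.
From mathcomp Require Import polyrcf.
From mathcomp Require Import all_classical all_reals all_analysis.

Set Implicit Arguments.
Unset Strict Implicit.
Unset Printing Implicit Defensive.

Import Order.TTheory GRing.Theory Num.Theory.
Import numFieldNormedType.Exports.

Local Open Scope classical_set_scope.
Local Open Scope ring_scope.

Section Matrices.
Variable R : realType.

Definition inner m n (X Y : 'M[R]_(m, n)) : R := \tr (X^T *m Y).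

(* Frobenius norm; on column vectors this is the Euclidean norm. *)
Definition fnorm m n (X : 'M[R]_(m, n)) : R := Num.sqrt (inner X X).

(* Real eigenvalues, listed with algebraic multiplicity. *)
Definition eigenvalues n (S : 'M[R]_n) : seq R :=
  flatten [seq nseq (mup x (char_poly S)) x | x <- rootsR (char_poly S)].

(* There are n of them: when m < n, at least n - m are zeros added to the usual
   list, which changes neither their sum nor their maximum. *)
Definition singular_values m n (X : 'M[R]_(m, n)) : seq R :=
  [seq Num.sqrt x | x <- eigenvalues (X^T *m X)].

Definition spectral_norm m n (X : 'M[R]_(m, n)) : R :=
  \big[Num.max/0]_(s <- singular_values X) s.

Definition nuclear_norm m n (X : 'M[R]_(m, n)) : R :=
  \sum_(s <- singular_values X) s.

Definition adjoint m n p (A : 'M[R]_(m, n) -> 'cV[R]_p) (y : 'cV[R]_p) :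
    'M[R]_(m, n) :=
  \matrix_(i, j) inner (A (delta_mx i j)) y.

Lemma innerE m n (X Y : 'M[R]_(m, n)) :
  inner X Y = \sum_i \sum_j X i j * Y i j.
Proof.
rewrite /inner /mxtrace exchange_big /=; apply: eq_bigr => j _.
by rewrite mxE; apply: eq_bigr => i _; rewrite mxE.
Qed.

Lemma adjointP m n p (A : {linear 'M[R]_(m, n) -> 'cV[R]_p}) X y :
  inner (A X) y = inner X (adjoint A y).
Proof.
rewrite [X in A X]matrix_sum_delta linear_sum /inner !linear_sum /=.
rewrite mulmx_suml linear_sum -/(inner _ _) innerE; apply: eq_bigr => i _.
rewrite linear_sum linear_sum mulmx_suml linear_sum; apply: eq_bigr => j _.
by rewrite !linearZ /= -scalemxAl linearZ mxE.
Qed.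

End Matrices.

Definition argmin (R : realType) (T : Type) (S : set T) (f : T -> R) : set T :=
  [set x | S x /\ forall z, S z -> f x <= f z].

Section Cones.
Variables (R : realType) (V : lmodType R) (nrm : V -> R).

Definition dist (x : V) (K : set V) : R := inf [set nrm (x - z) | z in K].

Definition tangent_cone (K : set V) (y : V) : set V :=
  [set d | (fun t : R => dist (y + t *: d) K) =o_ (0^'+) (fun t : R => t)].

Definition lin (D : set V) : set V := D `&` [set - d | d in D].

Definition set_add (A B : set V) : set V := [set a + b | a in A & b in B].

End Cones.

Section Problems.
Variables (R : realType) (m n p : nat).
Variables (A : 'M[R]_(m, n) -> 'cV[R]_p) (b : 'cV[R]_p).

Definition product_norm (u : R^o * 'M[R]_(m, n)) : R :=
  Num.sqrt (u.1 ^+ 2 + fnorm u.2 ^+ 2).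

Definition epi_spectral : set (R^o * 'M[R]_(m, n)) :=
  [set u | spectral_norm u.2 <= u.1].

Definition primal_objective (lambda : R) (X : 'M[R]_(m, n)) : R :=
  lambda * nuclear_norm X + 2^-1 * fnorm (A X - b) ^+ 2.

(* [xget] selects a minimizer, which exists when A is linear and lambda > 0; the
   value does not depend on the one selected. *)
Definition value_function (lambda : R) : R :=
  fnorm (A (xget 0 (argmin setT (primal_objective lambda))) - b).

Definition dual_objective (y : 'cV[R]_p) : R :=
  2^-1 * fnorm y ^+ 2 - inner b y.

Definition dual_feasible (lambda : R) : set 'cV[R]_p :=
  [set y | epi_spectral (lambda, adjoint A y)].

Definition dual_solution (lambda : R) : set 'cV[R]_p :=
  argmin (dual_feasible lambda) dual_objective.

Definition constraint_nondegenerate (lambda : R) (y : 'cV[R]_p) : Prop :=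
  set_add [set ((0, adjoint A z) : R^o * 'M[R]_(m, n)) | z in setT]
    (lin (tangent_cone product_norm epi_spectral (lambda, adjoint A y)))
  = setT.

End Problems.

(* Semismoothness of a real function of one real variable defined on the open set
   U (values of F outside U are irrelevant); Jacobians are then the numbers
   derive1 F x. *)
Section Semismooth.
Variables (R : realType) (U : set R) (F : R -> R).

Definition locally_lipschitz : Prop :=
  forall x, U x -> exists2 W, nbhs x W & [lipschitz F z | z in W].

Definition B_jacobian (x : R) : set R :=
  [set V | exists u : nat -> R,
    [/\ forall k, U (u k) /\ derivable F (u k) 1,
        u @ \oo --> x
      & (fun k => derive1 F (u k)) @ \oo --> V]].

Definition clarke_jacobian (x : R) : set R :=
  smallest (@convex_set R R^o) (B_jacobian x).

(* The O is uniform in the choice of V. *)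
Definition strongly_G_semismooth (x : R) : Prop :=
  exists C : R, \forall h \near 0^', forall V, clarke_jacobian (x + h) V ->
    `|F (x + h) - F x - V * h| <= C * `|h| ^+ 2.

Definition calmly_B_differentiable (x : R) : Prop :=
  exists D : R -> R,
    (forall h, (F (x + t * h) - F x) / t @[t --> 0^'+] --> D h) /\
    (fun h : R => F (x + h) - F x - D h) =O_ (0 : R) (fun h : R => `|h| ^+ 2).

Definition strongly_semismooth (x : R) : Prop :=
  [/\ open U, U x, locally_lipschitz,
      strongly_G_semismooth x & calmly_B_differentiable x].

End Semismooth.

(* Main.v *)
(* Write Z = A^* y.  The dual constraint is the quadratic matrix inequality
   S = l^2 - Z^T Z >= 0, with a multiplier L >= 0 such that L S = 0 and
   y = b - A (Z L).  Nondegeneracy makes N |-> (S N, A (Z N)) injective on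
   symmetric matrices, so that (y, L) is Lipschitz at lambda, and more generally
   depends Lipschitz-continuously on the residuals of approximate solutions.  From
   the solution at lambda + h one builds an approximate solution at
   lambda + (1 - e) h by moving (y, L, S) the fraction e towards its value at
   lambda, up to O(e h^2), along exactly complementary positive semidefinite
   pairs.  Hence the value function phi satisfies
     phi (lambda + (1 - e) h) = (1 - e) phi (lambda + h) + e phi lambda + O(e h^2),
   and e -> 0 gives G-semismoothness, while iterating gives the directional
   derivative with its quadratic remainder. *)
Require Import Defs.
From HB Require Import structures.
From mathcomp Require Import all_boot all_order all_algebra.
From mathcomp Require Import all_classical all_reals all_analysis.
From mathcomp Require Import spectral polyrcf complex ring lra.

Set Implicit Arguments.
Unset Strict Implicit.
Unset Printing Implicit Defensive.

Import Order.TTheory GRing.Theory Num.Theory.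
Import numFieldNormedType.Exports.

Local Open Scope classical_set_scope.
Local Open Scope ring_scope.

(** * Frobenius norm *)

Section FrobeniusNorm.
Variable R : realType.

(** The defect is divided by [e] before [e] tends to 0, so every error must be [O(e h^2)] uniformly
    in [e]; a mere [O(h^2)] would be useless. This rules out plain linear interpolation of [(L, S)]:
    it breaks complementarity, while stability is available only for pairs with an exactly zero
    product. The correction is made by congruences whose second-order terms all carry the factor
    [e]. Strong convexity in [y] alone bounds the error in [y] by a square root of the residual; the
    linear bound on the multiplier error supplied by nondegeneracy turns this into a Lipschitz
    bound. Having a single real parameter makes scaling towards [lambda] sufficient: the derivative
    at [lambda + h] is read off along the segment back to [lambda]. The hypothesis on [adjoint A b]
    makes the dual solution at [lambda] nonzero, so that taking its norm costs only a further
    quadratic error. *)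

Lemma innerC m n (X Y : 'M[R]_(m, n)) : inner X Y = inner Y X.
Proof. by rewrite /inner -mxtrace_tr trmx_mul trmxK. Qed.

Lemma innerDl m n (X X' Y : 'M[R]_(m, n)) :
  inner (X + X') Y = inner X Y + inner X' Y.
Proof. by rewrite /inner !(linearD, mulmxDl) /=. Qed.

Lemma innerDr m n (X Y Y' : 'M[R]_(m, n)) :
  inner X (Y + Y') = inner X Y + inner X Y'.
Proof. by rewrite ![inner X _]innerC innerDl. Qed.

Lemma innerZl m n a (X Y : 'M[R]_(m, n)) : inner (a *: X) Y = a * inner X Y.
Proof. by rewrite /inner !linearZ /= -scalemxAl !linearZ. Qed.

Lemma innerZr m n a (X Y : 'M[R]_(m, n)) : inner X (a *: Y) = a * inner X Y.
Proof. by rewrite ![inner X _]innerC innerZl. Qed.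

Lemma innerNl m n (X Y : 'M[R]_(m, n)) : inner (- X) Y = - inner X Y.
Proof. by rewrite -scaleN1r innerZl mulN1r. Qed.

Lemma innerNr m n (X Y : 'M[R]_(m, n)) : inner X (- Y) = - inner X Y.
Proof. by rewrite ![inner X _]innerC innerNl. Qed.

Lemma inner0l m n (Y : 'M[R]_(m, n)) : inner 0 Y = 0.
Proof. by rewrite -(scale0r 0) innerZl mul0r. Qed.

Lemma inner0r m n (Y : 'M[R]_(m, n)) : inner Y 0 = 0.
Proof. by rewrite innerC inner0l. Qed.

Definition inner_lin := (innerDl, innerDr, innerNl, innerNr, innerZl, innerZr).

Lemma inner_mull m n p (A : 'M[R]_(m, n)) (B : 'M[R]_(n, p)) (C : 'M[R]_(m, p)) :
  inner (A *m B) C = inner B (A^T *m C).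
Proof. by rewrite /inner trmx_mul mulmxA. Qed.

Lemma inner_mulr m n p (A : 'M[R]_(m, n)) (B : 'M[R]_(n, p)) (C : 'M[R]_(m, p)) :
  inner (A *m B) C = inner A (C *m B^T).
Proof. by rewrite /inner trmx_mul -mulmxA mxtrace_mulC -mulmxA. Qed.

Lemma innerT m n (X Y : 'M[R]_(m, n)) : inner X^T Y^T = inner X Y.
Proof. by rewrite /inner -mxtrace_tr trmx_mul !trmxK mxtrace_mulC. Qed.

Lemma inner1l n (X : 'M[R]_n) : inner 1%:M X = \tr X.
Proof. by rewrite /inner trmx1 mul1mx. Qed.

Lemma inner_ge0 m n (X : 'M[R]_(m, n)) : 0 <= inner X X.
Proof.
by rewrite innerE; do 2![apply: sumr_ge0 => ? _]; rewrite -expr2 sqr_ge0.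
Qed.

Lemma fnorm_sqr m n (X : 'M[R]_(m, n)) : fnorm X ^+ 2 = inner X X.
Proof. by rewrite sqr_sqrtr // inner_ge0. Qed.

Lemma fnorm_ge0 m n (X : 'M[R]_(m, n)) : 0 <= fnorm X.
Proof. exact: sqrtr_ge0. Qed.
Hint Resolve fnorm_ge0 : core.

Lemma inner_eq0 m n (X : 'M[R]_(m, n)) : inner X X = 0 -> X = 0.
Proof.
rewrite innerE => /eqP; rewrite psumr_eq0 => [/allP X0|i _]; last first.
  by apply: sumr_ge0 => j _; rewrite -expr2 sqr_ge0.
apply/matrixP => i j; rewrite mxE.
have := X0 i (mem_index_enum i); rewrite psumr_eq0 => [/allP Xi0|k _]; last first.
  by rewrite -expr2 sqr_ge0.
by have := Xi0 j (mem_index_enum j); rewrite mulf_eq0 orbb => /eqP.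
Qed.

Lemma fnorm_eq0 m n (X : 'M[R]_(m, n)) : fnorm X = 0 -> X = 0.
Proof. by move=> X0; apply: inner_eq0; rewrite -fnorm_sqr X0 expr0n. Qed.

Lemma fnorm0 m n : fnorm (0 : 'M[R]_(m, n)) = 0.
Proof. by rewrite /fnorm inner0l sqrtr0. Qed.

Lemma fnormZ m n a (X : 'M[R]_(m, n)) : fnorm (a *: X) = `|a| * fnorm X.
Proof.
by rewrite /fnorm innerZl innerZr mulrA -expr2 sqrtrM ?sqr_ge0 // sqrtr_sqr.
Qed.

Lemma fnormN m n (X : 'M[R]_(m, n)) : fnorm (- X) = fnorm X.
Proof. by rewrite -scaleN1r fnormZ normrN1 mul1r. Qed.

Lemma fnormT m n (X : 'M[R]_(m, n)) : fnorm X^T = fnorm X.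
Proof. by rewrite /fnorm innerT. Qed.

Lemma cauchy_schwarz m n (X Y : 'M[R]_(m, n)) : inner X Y <= fnorm X * fnorm Y.
Proof.
have [/fnorm_eq0 ->|X0] := eqVneq (fnorm X) 0; first by rewrite inner0l fnorm0 mul0r.
have [/fnorm_eq0 ->|Y0] := eqVneq (fnorm Y) 0; first by rewrite inner0r fnorm0 mulr0.
have Xp : 0 < fnorm X by rewrite lt_def X0 /=.
have Yp : 0 < fnorm Y by rewrite lt_def Y0 /=.
have := inner_ge0 (fnorm Y *: X - fnorm X *: Y).
rewrite !inner_lin -!fnorm_sqr (innerC Y X) => h.
have {}h : 0 <= (fnorm X * fnorm Y) * (fnorm X * fnorm Y - inner X Y) by nra.
by move: h; rewrite pmulr_rge0 ?mulr_gt0 // subr_ge0.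
Qed.

Lemma cauchy_schwarz_norm m n (X Y : 'M[R]_(m, n)) :
  `|inner X Y| <= fnorm X * fnorm Y.
Proof.
rewrite ler_norml cauchy_schwarz andbT lerNl -innerNl -(fnormN X).
exact: cauchy_schwarz.
Qed.

Lemma fnormD m n (X Y : 'M[R]_(m, n)) : fnorm (X + Y) <= fnorm X + fnorm Y.
Proof.
rewrite -ler_sqr ?nnegrE ?addr_ge0 // fnorm_sqr !inner_lin (innerC Y X).
rewrite -!fnorm_sqr; have := cauchy_schwarz X Y; nra.
Qed.

Lemma fnormB m n (X Y : 'M[R]_(m, n)) : fnorm (X - Y) <= fnorm X + fnorm Y.
Proof. by rewrite -(fnormN Y) fnormD. Qed.

Lemma fnorm_sub m n (X Y : 'M[R]_(m, n)) : fnorm (X - Y) = fnorm (Y - X).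
Proof. by rewrite -fnormN opprB. Qed.

Lemma fnorm_dist m n (X Y : 'M[R]_(m, n)) :
  `|fnorm X - fnorm Y| <= fnorm (X - Y).
Proof.
have le_fnorm (U V : 'M[R]_(m, n)) : fnorm U - fnorm V <= fnorm (U - V).
  by rewrite lerBlDr (le_trans _ (fnormD _ _)) // subrK.
by rewrite ler_norml le_fnorm andbT lerNl opprB fnorm_sub le_fnorm.
Qed.

Lemma fnorm_sum m n I (r : seq I) (P : pred I) (F : I -> 'M[R]_(m, n)) :
  fnorm (\sum_(i <- r | P i) F i) <= \sum_(i <- r | P i) fnorm (F i).
Proof.
elim/big_ind2: _ => [|a b c d ab cd|//]; first by rewrite fnorm0.
by rewrite (le_trans (fnormD _ _)) // lerD.
Qed.

Lemma fnorm_entry m n (X : 'M[R]_(m, n)) i j : `|X i j| <= fnorm X.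
Proof.
rewrite -ler_sqr ?nnegrE // fnorm_sqr innerE real_normK ?num_real //.
rewrite (bigD1 i) //= (bigD1 j) //= -expr2 -addrA lerDl addr_ge0 //.
  by apply: sumr_ge0 => k _; rewrite -expr2 sqr_ge0.
by do 2![apply: sumr_ge0 => ? _]; rewrite -expr2 sqr_ge0.
Qed.

Lemma fnormM m n p (X : 'M[R]_(m, n)) (Y : 'M[R]_(n, p)) :
  fnorm (X *m Y) <= fnorm X * fnorm Y.
Proof.
rewrite -ler_sqr ?nnegrE ?mulr_ge0 // exprMn !fnorm_sqr.
rewrite -(innerT Y) !innerE mulr_suml; apply: ler_sum => i _.
rewrite mulr_sumr; apply: ler_sum => j _.
have -> : (X *m Y) i j = inner (row i X) (row j Y^T).
  by rewrite innerE big_ord1 mxE; apply: eq_bigr => k _; rewrite !mxE.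
rewrite -expr2 -real_normK ?num_real //.
have -> : \sum_k X i k * X i k = fnorm (row i X) ^+ 2.
  by rewrite fnorm_sqr innerE big_ord1; apply: eq_bigr => l _; rewrite !mxE.
have -> : \sum_k Y^T j k * Y^T j k = fnorm (row j Y^T) ^+ 2.
  by rewrite fnorm_sqr innerE big_ord1; apply: eq_bigr => l _; rewrite !mxE.
by rewrite -exprMn lerXn2r ?nnegrE ?mulr_ge0 // cauchy_schwarz_norm.
Qed.

Lemma linear_bounded m n p q (f : {linear 'M[R]_(m, n) -> 'M[R]_(p, q)}) :
  exists2 C, 0 <= C & forall X, fnorm (f X) <= C * fnorm X.
Proof.
exists (\sum_i \sum_j fnorm (f (delta_mx i j))) => [|X].
  by do 2![apply: sumr_ge0 => ? _].
rewrite [X in f X]matrix_sum_delta linear_sum mulr_suml.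
apply: (le_trans (fnorm_sum _ _ _)); apply: ler_sum => i _.
rewrite linear_sum mulr_suml.
apply: (le_trans (fnorm_sum _ _ _)); apply: ler_sum => j _.
by rewrite linearZ fnormZ mulrC ler_wpM2l // fnorm_entry.
Qed.

End FrobeniusNorm.
#[global] Hint Extern 0 (is_true (0 <= fnorm _)) => exact: fnorm_ge0 : core.

(** * Spectral theorem for real symmetric matrices *)

Section Spectral.
Variable R : realType.

(** Over the complex numbers some eigenvector [x + i y] exists. Comparing [inner (x *m S) y] with
    [inner x (y *m S)] kills the imaginary part of the eigenvalue, so whichever of [x], [y] is
    nonzero is a real eigenvector. *)
Lemma symmetric_eigenvector n (S : 'M[R]_n.+1) : S^T = S ->
  exists a (v : 'rV[R]_n.+1), v *m S = a *: v /\ fnorm v = 1.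
Proof.
move=> Ssym; pose toC := real_complex R.
have [a /eigenvalueP[v vS v0]] := eigenvalue_closed (map_mx toC S) (ltn0Sn n).
pose x : 'rV[R]_n.+1 := map_mx (@complex.Re R) v.
pose y : 'rV[R]_n.+1 := map_mx (@complex.Im R) v.
case: a vS => [a1 a2] vS.
have entry j : \sum_k v 0 k * toC (S k j) = (a1 +i* a2)%C * v 0 j.
  by have /rowP/(_ j) := vS; rewrite !mxE => <-; apply: eq_bigr => k _; rewrite mxE.
have xS : x *m S = a1 *: x - a2 *: y.
  apply/rowP => j; rewrite !mxE.
  have /(congr1 (@complex.Re R)) := entry j.
  rewrite (raddf_sum (@complex.Re R)) /=; case: (v 0 j) => ? ? /= <-.
  by apply: eq_bigr => k _; rewrite mxE /toC; case: (v 0 k) => ? ? /=; ring.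
have yS : y *m S = a1 *: y + a2 *: x.
  apply/rowP => j; rewrite !mxE.
  have /(congr1 (@complex.Im R)) := entry j.
  rewrite (raddf_sum (@complex.Im R)) /=; case: (v 0 j) => ? ? /= <-.
  by apply: eq_bigr => k _; rewrite mxE /toC; case: (v 0 k) => ? ? /=; ring.
have xy0 : inner x x + inner y y != 0.
  apply: contra_neq v0 => xy0.
  have x0 : x = 0 by apply: inner_eq0; have := inner_ge0 x; have := inner_ge0 y; lra.
  have y0 : y = 0 by apply: inner_eq0; have := inner_ge0 x; have := inner_ge0 y; lra.
  apply/rowP => j; rewrite mxE.
  have := congr1 (fun M : 'rV[R]_n.+1 => M 0 j) x0.
  have := congr1 (fun M : 'rV[R]_n.+1 => M 0 j) y0.
  by rewrite !mxE; case: (v 0 j) => ? ? /= -> ->.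
have : inner (x *m S) y = inner x (y *m S) by rewrite inner_mulr Ssym.
rewrite xS yS !inner_lin => h.
have /eqP : a2 * (inner x x + inner y y) = 0 by lra.
rewrite mulf_eq0 (negbTE xy0) orbF => /eqP a20.
have normal (u : 'rV[R]_n.+1) : u != 0 -> u *m S = a1 *: u ->
    exists a (v : 'rV[R]_n.+1), v *m S = a *: v /\ fnorm v = 1.
  move=> u0 uS; exists a1, ((fnorm u)^-1 *: u).
  rewrite -scalemxAl uS !scalerA mulrC; split=> //.
  rewrite fnormZ gtr0_norm ?mulVf ?invr_gt0 ?lt_def ?fnorm_ge0 ?andbT //.
    by apply: contra_neq u0; exact: fnorm_eq0.
  by apply: contra_neq u0; exact: fnorm_eq0.
have [x0|x0] := eqVneq x 0; last by apply: (normal x) => //; rewrite xS a20 scale0r subr0.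
apply: (normal y); last by rewrite yS a20 scale0r addr0.
by apply: contra_neq xy0 => y0; rewrite x0 y0 inner0l addr0.
Qed.

(* Householder reflection exchanging e_0 and v. *)
Lemma orthogonal_first_row n (v : 'rV[R]_n.+1) : fnorm v = 1 ->
  exists H : 'M[R]_n.+1, [/\ H^T = H, H *m H = 1%:M & delta_mx 0 0 *m H = v].
Proof.
move=> v1; pose e : 'rV[R]_n.+1 := delta_mx 0 0.
have [ve|ve] := eqVneq v e.
  by exists 1%:M; split; rewrite ?trmx1 ?mulmx1 ?ve.
have [w wE] : {w | w = v - e} by exists (v - e).
pose c := inner w w.
have c0 : c != 0 by apply: contra_neq ve => /inner_eq0/eqP; rewrite wE subr_eq0 => /eqP.
have ee : inner e e = 1.
  rewrite innerE big_ord1 (bigD1 0) //= big1 ?addr0 ?mxE ?eqxx ?mulr1 // => i i0.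
  by rewrite mxE eqxx (negbTE i0) mulr0.
have vv : inner v v = 1 by rewrite -fnorm_sqr v1 expr1n.
have innerM (x y : 'rV[R]_n.+1) : x *m y^T = (inner x y)%:M.
  rewrite [LHS]mx11_scalar; congr (_%:M); rewrite innerE big_ord1 mxE.
  by apply: eq_bigr => i _; rewrite mxE.
have cE : c = 2 - 2 * inner e v.
  by rewrite /c wE !inner_lin vv ee (innerC v e); lra.
exists (1%:M - (2 / c) *: (w^T *m w)); split.
- by rewrite linearB linearZ /= trmx_mul trmxK trmx1.
- rewrite mulmxBl mul1mx mulmxBr mulmx1 -scalemxAl -scalemxAr scalerA.
  rewrite mulmxA -(mulmxA w^T) innerM -/c mul_mx_scalar -scalemxAl scalerA.
  have -> : 2 / c * (2 / c) * c = 2 / c + 2 / c by field.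
  by rewrite scalerDl opprB addrK subrK.
- rewrite mulmxBr mulmx1 -scalemxAr mulmxA innerM mul_scalar_mx scalerA.
  have -> : 2 / c * inner e w = - 1.
    by rewrite {1}wE !inner_lin ee; have -> : inner e v - 1 = - c / 2; [rewrite cE; field|field].
  by rewrite scaleN1r opprK wE addrC subrK.
Qed.

(** Conjugating by the reflection that exchanges the first basis vector and an eigenvector clears
    the first row; symmetry clears the first column, and induction applies to the remaining
    block. *)
Lemma symmetric_spectral n (S : 'M[R]_n) : S^T = S ->
  exists (U : 'M[R]_n) (d : 'rV[R]_n),
    U *m U^T = 1%:M /\ S = U *m diag_mx d *m U^T.
Proof.
elim: n S => [|n IHn] S Ssym.
  by exists 0, 0; split; apply/matrixP => -[].
have [a [v [vS v1]]] := symmetric_eigenvector Ssym.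
have [H [Hsym HH eH]] := orthogonal_first_row v1.
have [S' S'def] : {S' : 'M[R]_(1 + n) | S' = H *m S *m H} by exists (H *m S *m H).
have S'sym : S'^T = S' by rewrite S'def !trmx_mul Hsym Ssym mulmxA.
have row0 : delta_mx 0 0 *m S' = a *: (delta_mx 0 0 : 'rV[R]_n.+1).
  by rewrite S'def !mulmxA eH vS -scalemxAl -eH -mulmxA HH mulmx1.
have S'0 j : S' 0 j = a * (j == 0)%:R.
  have /rowP/(_ j) := row0; rewrite -rowE !mxE => <-.
  by [].
have S'E : S' = block_mx a%:M 0 0 (drsubmx S').
  rewrite -[LHS]submxK; congr block_mx.
  - apply/matrixP => i j; rewrite !ord1 !mxE lshift0 S'0 eqxx mulr1 //.
  - apply/matrixP => i j; rewrite !ord1 !mxE lshift0 S'0.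
    by rewrite -val_eqE /= mulr0.
  - apply/matrixP => i j; rewrite !ord1 -S'sym !mxE lshift0 S'0.
    by rewrite -val_eqE /= mulr0.
have [|U [d [UU dU]]] := IHn (drsubmx S').
  by rewrite trmx_drsub S'sym.
pose B : 'M[R]_(1 + n) := block_mx 1%:M 0 0 U.
pose D : 'rV[R]_(1 + n) := row_mx a%:M d.
have BB : B *m B^T = 1%:M.
  rewrite tr_block_mx !trmx0 trmx1 mulmx_block.
  by rewrite !(mul0mx, mulmx0, mul1mx, mulmx1, addr0, add0r) UU -scalar_mx_block.
have BD : S' = B *m diag_mx D *m B^T.
  rewrite S'E dU diag_mx_row tr_block_mx !trmx0 trmx1 !mulmx_block.
  rewrite !(mul0mx, mulmx0, mul1mx, mulmx1, addr0, add0r).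
  by congr block_mx; apply/matrixP => i j; rewrite !ord1 !mxE eqxx.
exists (H *m B), D; split.
  by rewrite trmx_mul Hsym mulmxA -(mulmxA H) BB mulmx1 HH.
have -> : S = H *m S' *m H by rewrite S'def !mulmxA HH mul1mx -mulmxA HH mulmx1.
by rewrite {1}BD trmx_mul Hsym !mulmxA.
Qed.

End Spectral.

(** * Semidefinite matrices and singular values *)

Section Semidefinite.
Variable R : realType.

(** A Gram factorization rather than a sign condition: congruences, inner products and vanishing
    products become algebra on the factors. [psdP] gives the usual form. *)
Definition psd n (S : 'M[R]_n) : Prop := exists F : 'M[R]_n, S = F^T *m F.

Lemma psd_sym n (S : 'M[R]_n) : psd S -> S^T = S.
Proof. by move=> [F ->]; rewrite trmx_mul trmxK. Qed.

Lemma col_orthonormal n (U : 'M[R]_n) i : U *m U^T = 1%:M ->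
  inner (col i U) (col i U) = 1.
Proof.
move=> /mulmx1C/matrixP/(_ i i); rewrite !mxE eqxx mulr1n => <-.
by rewrite innerE; apply: eq_bigr => k _; rewrite big_ord1 !mxE.
Qed.

Lemma diag_mul_col n (U : 'M[R]_n) (d : 'rV[R]_n) i : U *m U^T = 1%:M ->
  (U *m diag_mx d *m U^T) *m col i U = d 0 i *: col i U.
Proof.
move=> UU; rewrite colE mulmxA -(mulmxA _ U^T) (mulmx1C UU) mulmx1 -mulmxA.
rewrite scalemxAr; congr (U *m _); apply/colP => k; rewrite mul_diag_mx !mxE.
by case: eqP => [->|_]; rewrite ?mulr0.
Qed.

Lemma psdP n (S : 'M[R]_n) :
  psd S <-> S^T = S /\ forall v : 'cV[R]_n, 0 <= inner v (S *m v).
Proof.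
split=> [Spsd|[Ssym Sge0]].
  split=> [|v]; first exact: psd_sym.
  by have [F ->] := Spsd; rewrite -mulmxA -[F^T]/(F^T) innerC inner_mull trmxK inner_ge0.
have [U [d [UU SE]]] := symmetric_spectral Ssym.
have d_ge0 i : 0 <= d 0 i.
  by have := Sge0 (col i U); rewrite SE diag_mul_col // innerZr col_orthonormal // mulr1.
exists (diag_mx (map_mx Num.sqrt d) *m U^T).
rewrite trmx_mul trmxK tr_diag_mx mulmxA -(mulmxA U) mulmx_diag SE.
congr (_ *m diag_mx _ *m _); apply/rowP => i; rewrite !mxE.
by rewrite -expr2 sqr_sqrtr.
Qed.

Lemma psd_spectral n (S : 'M[R]_n) : psd S ->
  exists (U : 'M[R]_n) (d : 'rV[R]_n),
    [/\ U *m U^T = 1%:M, S = U *m diag_mx d *m U^T & forall i, 0 <= d 0 i].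
Proof.
move=> /psdP[/symmetric_spectral[U [d [UU SE]]] Sge0]; exists U, d; split=> // i.
by have := Sge0 (col i U); rewrite SE diag_mul_col // innerZr col_orthonormal // mulr1.
Qed.

Lemma psd_congr n (C S : 'M[R]_n) : psd S -> psd (C *m S *m C^T).
Proof. by move=> [F ->]; exists (F *m C^T); rewrite trmx_mul trmxK !mulmxA. Qed.

Lemma psdD n (S T : 'M[R]_n) : psd S -> psd T -> psd (S + T).
Proof.
move=> /psdP[Ssym Sge0] /psdP[Tsym Tge0]; apply/psdP; split=> [|v].
  by rewrite linearD /= Ssym Tsym.
by rewrite mulmxDl innerDr addr_ge0.
Qed.

Lemma psdZ n a (S : 'M[R]_n) : 0 <= a -> psd S -> psd (a *: S).
Proof.
move=> a0 [F ->]; exists (Num.sqrt a *: F).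
by rewrite [(_ *: F)^T]linearZ /= -scalemxAl -scalemxAr scalerA -expr2 sqr_sqrtr.
Qed.

Lemma psd_gram m n (X : 'M[R]_(m, n)) : psd (X^T *m X).
Proof.
apply/psdP; split=> [|v]; first by rewrite trmx_mul trmxK.
by rewrite -mulmxA -{2}(trmxK X) -inner_mull trmxK inner_ge0.
Qed.

Lemma psd_scalar n a : 0 <= a -> psd (a%:M : 'M[R]_n).
Proof.
by move=> a0; rewrite -scalemx1; apply: psdZ => //; exists 1%:M; rewrite trmx1 mulmx1.
Qed.

(** Nonnegativity of the inner product of two semidefinite matrices, and its equality case, are both
    read off from this square. *)
Lemma inner_gram n (F G : 'M[R]_n) :
  inner (F^T *m F) (G^T *m G) = fnorm (F *m G^T) ^+ 2.
Proof.
by rewrite fnorm_sqr inner_mull trmxK [RHS]inner_mulr trmxK -mulmxA.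
Qed.

Lemma psd_inner_ge0 n (S T : 'M[R]_n) : psd S -> psd T -> 0 <= inner S T.
Proof. by move=> [F ->] [G ->]; rewrite inner_gram sqr_ge0. Qed.

Lemma psd_inner_eq0 n (S T : 'M[R]_n) :
  psd S -> psd T -> inner S T = 0 -> S *m T = 0.
Proof.
move=> [F ->] [G ->]; rewrite inner_gram => /eqP.
rewrite sqrf_eq0 => /eqP/fnorm_eq0 FG.
by rewrite -mulmxA (mulmxA F) FG mul0mx mulmx0.
Qed.

Lemma psd_fnorm_le_trace n (S : 'M[R]_n) : psd S -> fnorm S <= \tr S.
Proof.
move=> [F ->]; rewrite (le_trans (fnormM _ _)) // fnormT -expr2 fnorm_sqr.
by rewrite /inner.
Qed.

(** Eigenvalues are inverted with the convention [0^-1 = 0], so [J] is the Moore-Penrose inverse. *)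
Lemma psd_pinv n (S : 'M[R]_n) : psd S ->
  exists J, [/\ psd J, S *m J *m S = S & J *m S = S *m J].
Proof.
move=> /psd_spectral[U [d [UU SE d_ge0]]]; have UU' := mulmx1C UU.
pose conj e := U *m diag_mx e *m U^T.
have conjM e f : conj e *m conj f = conj (\row_i (e 0 i * f 0 i)).
  rewrite /conj -!mulmxA (mulmxA U^T) UU' mul1mx (mulmxA (diag_mx e)).
  by rewrite mulmx_diag.
exists (conj (\row_i (d 0 i)^-1)); split.
- exists (diag_mx (\row_i Num.sqrt (d 0 i)^-1) *m U^T).
  rewrite trmx_mul trmxK tr_diag_mx mulmxA -(mulmxA U) mulmx_diag.
  congr (_ *m diag_mx _ *m _); apply/rowP => i; rewrite !mxE.
  by rewrite -expr2 sqr_sqrtr // invr_ge0.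
- rewrite SE -/(conj d) !conjM; congr conj; apply/rowP => i; rewrite !mxE.
  by have [->|di0] := eqVneq (d 0 i) 0; rewrite ?mulr0 // divff // mul1r.
- by rewrite SE -/(conj d) !conjM; congr conj; apply/rowP => i; rewrite !mxE mulrC.
Qed.

Lemma psd_sqrt n (S : 'M[R]_n) : psd S -> exists2 H, psd H & H *m H = S.
Proof.
move=> /psd_spectral[U [d [UU SE d_ge0]]]; have UU' := mulmx1C UU.
exists (U *m diag_mx (map_mx Num.sqrt d) *m U^T).
  apply/psd_congr; exists (diag_mx (map_mx (Num.sqrt \o Num.sqrt) d)).
  rewrite tr_diag_mx mulmx_diag; congr diag_mx; apply/rowP => i; rewrite !mxE /=.
  by rewrite -expr2 sqr_sqrtr ?sqrtr_ge0.
rewrite SE -!mulmxA (mulmxA U^T) UU' mul1mx (mulmxA (diag_mx _)) mulmx_diag.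
congr (_ *m (diag_mx _ *m _)); apply/rowP => i; rewrite !mxE.
by rewrite -expr2 sqr_sqrtr.
Qed.

End Semidefinite.

(** * Singular values through the spectrum of the Gram matrix *)

Section SingularValues.
Variable R : realType.

Lemma char_poly_orthogonal n (U : 'M[R]_n) (d : 'rV[R]_n) : U *m U^T = 1%:M ->
  char_poly (U *m diag_mx d *m U^T) = \prod_(i < n) ('X - (d 0 i)%:P).
Proof.
move=> UU; rewrite /char_poly /char_poly_mx.
have -> : 'X%:M - map_mx polyC (U *m diag_mx d *m U^T) =
   map_mx polyC U *m ('X%:M - map_mx polyC (diag_mx d)) *m map_mx polyC U^T.
  rewrite mulmxBr mulmxBl !map_mxM; congr (_ - _).
  by rewrite scalar_mxC -mulmxA -map_mxM UU map_mx1 mulmx1.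
rewrite !det_mulmx mulrAC -det_mulmx -map_mxM UU map_mx1 det1 mul1r.
rewrite -[LHS]/(char_poly (diag_mx d)) char_poly_trig.
  by apply: eq_bigr => i _; rewrite mxE eqxx.
by apply/is_trig_mxP => i j ij; rewrite mxE -val_eqE ltn_eqF.
Qed.

Lemma mup_prod_XsubC (s : seq R) x :
  mup x (\prod_(y <- s) ('X - y%:P)) = count_mem x s.
Proof.
elim: s => [|y s IHs]; first by rewrite big_nil mupNroot // root1.
rewrite big_cons mupM ?polyXsubC_eq0 ?IHs //=; last first.
  by rewrite monic_neq0 // monic_prod_XsubC.
by rewrite -['X - _]expr1 mup_XsubCX eq_sym; case: eqP.
Qed.

Lemma eigenvalues_perm n (U : 'M[R]_n) (d : 'rV[R]_n) : U *m U^T = 1%:M ->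
  perm_eq (eigenvalues (U *m diag_mx d *m U^T)) [seq d 0 i | i <- enum 'I_n].
Proof.
move=> UU; set p := char_poly (U *m diag_mx d *m U^T).
have pE : p = \prod_(y <- [seq d 0 i | i <- enum 'I_n]) ('X - y%:P).
  by rewrite /p char_poly_orthogonal // big_map big_enum.
have p0 : p != 0 by rewrite monic_neq0 // char_poly_monic.
have mupE x : mup x p = count_mem x [seq d 0 i | i <- enum 'I_n].
  by rewrite pE mup_prod_XsubC.
apply/allP => x _ /=; rewrite -mupE /eigenvalues -/p count_flatten -map_comp.
have sumE s : uniq s -> sumn [seq (count_mem x \o (fun y => nseq (mup y p) y)) y | y <- s]
    = ((x \in s) * mup x p)%N.
  elim: s => [|y s IHs] //= /andP[ys us]; rewrite IHs // count_nseq in_cons /= eq_sym.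
  by case: eqVneq ys => [->|_ _] //= /negbTE ->; rewrite mul0n addn0.
rewrite sumE ?uniq_roots // -roots_on_rootsR // in_itv /=.
case: (boolP (root p x)) => [_|/mupNroot ->]; first by rewrite mul1n.
by rewrite muln0.
Qed.

Lemma nuclear_normE m n (X : 'M[R]_(m, n)) (H : 'M[R]_n) :
  psd H -> H *m H = X^T *m X -> nuclear_norm X = \tr H.
Proof.
move=> /psd_spectral[U [d [UU HE d_ge0]]] HH; have UU' := mulmx1C UU.
rewrite /nuclear_norm /singular_values -HH HE -!mulmxA (mulmxA U^T) UU' mul1mx.
rewrite (mulmxA (diag_mx d)) mulmx_diag mulmxA big_map.
rewrite (perm_big _ (eigenvalues_perm _ UU)) big_map big_enum /=.
rewrite mulmxA mxtrace_mulC mulmxA UU' mul1mx mxtrace_diag.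
by apply: eq_bigr => i _; rewrite mxE -expr2 sqrtr_sqr ger0_norm.
Qed.

(** Diagonalizing the Gram matrix turns a maximum of singular values into a semidefinite inequality.
    The sign of [t] matters because squaring would otherwise admit negative bounds. *)
Lemma spectral_normP m n (X : 'M[R]_(m, n)) t : 0 <= t ->
  spectral_norm X <= t <-> psd (t ^+ 2 *: 1%:M - X^T *m X).
Proof.
move=> t0; have [U [d [UU GE d_ge0]]] := psd_spectral (psd_gram X).
have specE : spectral_norm X = \big[Num.max/0]_(i < n) Num.sqrt (d 0 i).
  rewrite /spectral_norm /singular_values GE big_map.
  by rewrite (perm_big _ (eigenvalues_perm _ UU)) big_map big_enum.
rewrite specE; split=> [/bigmax_leP[_ dt]|/psdP[_ Sge0]].
  have -> : t ^+ 2 *: 1%:M - X^T *m X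
      = U *m diag_mx (\row_i (t ^+ 2 - d 0 i)) *m U^T.
    have -> : diag_mx (\row_i (t ^+ 2 - d 0 i)) = t ^+ 2 *: 1%:M - diag_mx d.
      apply/matrixP => i j; rewrite !mxE.
      by case: eqP => _; rewrite ?mulr1n ?mulr0n ?mulr1 ?mulr0 ?subr0.
    by rewrite mulmxBr mulmxBl -GE -scalemxAr mulmx1 -scalemxAl UU.
  apply: psd_congr; exists (diag_mx (\row_i Num.sqrt (t ^+ 2 - d 0 i))).
  rewrite tr_diag_mx mulmx_diag; congr diag_mx; apply/rowP => i; rewrite !mxE.
  rewrite -expr2 sqr_sqrtr // subr_ge0 -(sqr_sqrtr (d_ge0 i)).
  by rewrite lerXn2r ?nnegrE ?sqrtr_ge0 // dt.
apply/bigmax_leP; split=> // i _.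
rewrite -(ger0_norm t0) -sqrtr_sqr ler_wsqrtr //.
have := Sge0 (col i U); rewrite mulmxBl GE diag_mul_col //.
by rewrite -scalemxAl mul1mx !inner_lin col_orthonormal // !mulr1 subr_ge0.
Qed.

End SingularValues.

(** * Nuclear norm and existence of primal solutions *)

Section NuclearNorm.
Variable R : realType.

(** For semidefinite [H], [inner (U *m H) V] is a semi-inner product; with a multiplier as [H] it
    stands in for convexity of the spectral ball. *)
Lemma weighted_inner_ge0 m n (H : 'M[R]_n) (U : 'M[R]_(m, n)) :
  psd H -> 0 <= inner (U *m H) U.
Proof.
by move=> Hpsd; rewrite inner_mull; apply: psd_inner_ge0 => //; exact: psd_gram.
Qed.

Lemma weighted_innerC m n (H : 'M[R]_n) (U V : 'M[R]_(m, n)) :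
  psd H -> inner (U *m H) V = inner (V *m H) U.
Proof. by move=> /psd_sym Hsym; rewrite [RHS]inner_mulr Hsym innerC. Qed.

Lemma weighted_inner_le m n (H : 'M[R]_n) (U V : 'M[R]_(m, n)) : psd H ->
  inner (U *m H) V <= (inner (U *m H) U + inner (V *m H) V) / 2.
Proof.
move=> Hpsd; have := weighted_inner_ge0 (U - V) Hpsd.
rewrite mulmxBl !inner_lin (weighted_innerC V U) //; lra.
Qed.

Lemma weighted_inner_bound m n (H : 'M[R]_n) (W : 'M[R]_(m, n)) t : psd H ->
  psd (t ^+ 2 *: 1%:M - W^T *m W) -> inner (W *m H) W <= t ^+ 2 * \tr H.
Proof.
move=> Hpsd Wpsd; have := psd_inner_ge0 Hpsd Wpsd.
by rewrite !inner_lin (innerC H) inner1l -inner_mull subr_ge0.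
Qed.

(** [W] is [X *m J] with [J] the pseudo-inverse of [H]. Its Gram matrix [H *m J] is an orthogonal
    projection, which makes [W] a contraction. *)
Lemma polar_decomposition m n (X : 'M[R]_(m, n)) :
  exists (H : 'M[R]_n) (W : 'M[R]_(m, n)),
  [/\ psd H, H *m H = X^T *m X, psd (1 ^+ 2 *: 1%:M - W^T *m W),
      X = W *m H & inner W X = \tr H].
Proof.
have [H Hpsd HH] := psd_sqrt (psd_gram X).
have [J [Jpsd HJH JH]] := psd_pinv Hpsd.
have [Hsym Jsym] := (psd_sym Hpsd, psd_sym Jpsd).
(* [X] and [H] have the same Gram matrix, so [X] kills [1 - J *m H] because [H] does. *)
have XJH : X = X *m J *m H.
  apply/eqP; rewrite -subr_eq0; apply/eqP/inner_eq0.
  rewrite -[X in X - _]mulmx1 -mulmxA -mulmxBr inner_mull mulmxA -HH -mulmxA.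
  by rewrite mulmxBr mulmx1 mulmxA HJH subrr mulmx0 inner0r.
have WW : (X *m J)^T *m (X *m J) = H *m J.
  by rewrite trmx_mul Jsym mulmxA -(mulmxA J) -HH !mulmxA JH HJH.
exists H, (X *m J); split=> //.
  rewrite WW expr1n scale1r; exists (1%:M - H *m J).
  rewrite [(_ - _)^T]linearB /= trmx1 trmx_mul Hsym Jsym JH mulmxBl mul1mx mulmxBr mulmx1.
  by rewrite mulmxA HJH subrr subr0.
by rewrite /inner trmx_mul Jsym -mulmxA -HH mulmxA JH HJH.
Qed.

(** Together with [inner_le_nuclear_norm], this exhibits the nuclear norm as the support function of
    the spectral unit ball, from which sublinearity follows. *)
Lemma nuclear_norm_polar m n (X : 'M[R]_(m, n)) :
  exists2 W : 'M[R]_(m, n), psd (1 ^+ 2 *: 1%:M - W^T *m W)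
                          & nuclear_norm X = inner W X.
Proof.
have [H [W [Hpsd HH Wpsd _ WX]]] := polar_decomposition X.
by exists W => //; rewrite WX (nuclear_normE Hpsd HH).
Qed.

Lemma inner_le_nuclear_norm m n (W X : 'M[R]_(m, n)) :
  psd (1 ^+ 2 *: 1%:M - W^T *m W) -> inner W X <= nuclear_norm X.
Proof.
have [H [V [Hpsd HH Vpsd XE _]]] := polar_decomposition X.
move=> Wpsd; rewrite (nuclear_normE Hpsd HH) XE innerC.
have := weighted_inner_le V W Hpsd.
have := weighted_inner_bound Hpsd Vpsd; have := weighted_inner_bound Hpsd Wpsd.
rewrite expr1n; lra.
Qed.

Lemma nuclear_normD m n (X Y : 'M[R]_(m, n)) :
  nuclear_norm (X + Y) <= nuclear_norm X + nuclear_norm Y.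
Proof.
have [W Wpsd ->] := nuclear_norm_polar (X + Y).
by rewrite innerDr lerD // inner_le_nuclear_norm.
Qed.

Lemma nuclear_normZ m n a (X : 'M[R]_(m, n)) : 0 <= a ->
  nuclear_norm (a *: X) <= a * nuclear_norm X.
Proof.
move=> a0; have [W Wpsd ->] := nuclear_norm_polar (a *: X).
by rewrite innerZr ler_wpM2l // inner_le_nuclear_norm.
Qed.

Lemma fnorm_le_nuclear_norm m n (X : 'M[R]_(m, n)) : fnorm X <= nuclear_norm X.
Proof.
have [H Hpsd HH] := psd_sqrt (psd_gram X).
rewrite (nuclear_normE Hpsd HH); apply: le_trans (psd_fnorm_le_trace Hpsd).
by rewrite /fnorm /inner -HH (psd_sym Hpsd).
Qed.

Lemma nuclear_norm0 m n : nuclear_norm (0 : 'M[R]_(m, n)) = 0.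
Proof. by have [W _ ->] := nuclear_norm_polar (0 : 'M[R]_(m, n)); rewrite inner0r. Qed.

Lemma nuclear_norm_le_fnorm m n (X : 'M[R]_(m, n)) :
  nuclear_norm X <= Num.sqrt n%:R * fnorm X.
Proof.
have [W Wpsd ->] := nuclear_norm_polar X.
apply: le_trans (cauchy_schwarz _ _) _; rewrite ler_wpM2r // /fnorm ler_wsqrtr //.
(* The trace of [1 - W^T W] is nonnegative, so the squared Frobenius norm of [W] is at most [n]. *)
have := psd_inner_ge0 Wpsd (psd_scalar n (ler01 : 0 <= 1 :> R)).
by rewrite innerC inner1l linearB /= expr1n scale1r mxtrace1 subr_ge0.
Qed.

Lemma nuclear_norm_dist m n (X Y : 'M[R]_(m, n)) :
  `|nuclear_norm X - nuclear_norm Y| <= Num.sqrt n%:R * fnorm (X - Y).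
Proof.
have le_nuc (U V : 'M[R]_(m, n)) :
    nuclear_norm U - nuclear_norm V <= Num.sqrt n%:R * fnorm (U - V).
  rewrite lerBlDr; apply: le_trans (lerD (nuclear_norm_le_fnorm _) (lexx _)).
  by rewrite (le_trans _ (nuclear_normD _ _)) // subrK.
by rewrite ler_norml le_nuc andbT lerNl opprB fnorm_sub le_nuc.
Qed.

Lemma nuclear_norm_outer m n (u : 'cV[R]_m) (v : 'cV[R]_n) :
  nuclear_norm (u *m v^T) <= fnorm u * fnorm v.
Proof.
have [W Wpsd ->] := nuclear_norm_polar (u *m v^T).
rewrite innerC inner_mulr trmxK; apply: le_trans (cauchy_schwarz _ _) _.
rewrite ler_wpM2l // -ler_sqr ?nnegrE // !fnorm_sqr inner_mull.
have [_ /(_ v)] := (psdP _).1 Wpsd.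
by rewrite expr1n scale1r mulmxBl mul1mx innerDr innerNr mulmxA subr_ge0.
Qed.

End NuclearNorm.

Section Adjoint.
Variables (R : realType) (m n p : nat) (A : {linear 'M[R]_(m, n) -> 'cV[R]_p}).

Lemma adjointD y z : adjoint A (y + z) = adjoint A y + adjoint A z.
Proof. by apply/matrixP => i j; rewrite !mxE innerDr. Qed.

Lemma adjointZ a y : adjoint A (a *: y) = a *: adjoint A y.
Proof. by apply/matrixP => i j; rewrite !mxE innerZr. Qed.

Lemma adjointB y z : adjoint A (y - z) = adjoint A y - adjoint A z.
Proof. by rewrite adjointD -scaleN1r adjointZ scaleN1r. Qed.

Lemma adjoint0 : adjoint A 0 = 0.
Proof. by rewrite -(scale0r 0) adjointZ scale0r. Qed.

Lemma adjoint_bounded : exists2 C, 0 <= C &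
  (forall X, fnorm (A X) <= C * fnorm X) /\
  (forall y, fnorm (adjoint A y) <= C * fnorm y).
Proof.
have [C C0 AC] := linear_bounded A; exists C => //; split=> // y.
have [->|Z0] := eqVneq (fnorm (adjoint A y)) 0; first by rewrite mulr_ge0.
have Zp : 0 < fnorm (adjoint A y) by rewrite lt_def Z0 fnorm_ge0.
rewrite -(ler_pM2l Zp) -expr2 fnorm_sqr -adjointP.
rewrite (le_trans (cauchy_schwarz _ _)) // mulrA ler_wpM2r //.
by rewrite (mulrC _ C).
Qed.

End Adjoint.

(** * Existence of a primal minimizer by compactness *)

Section Existence.
Variable R : realType.

(** The topology on row vectors is that of the maximum norm, hence the comparisons with the
    Frobenius norm. *)
Lemma fnorm_le_mx_norm n (v : 'rV[R]_n) : fnorm v <= n%:R * `|v|.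
Proof.
rewrite {1}[v]row_sum_delta; apply: le_trans (fnorm_sum _ _ _) _.
apply: (@le_trans _ _ (\sum_(i < n) `|v|)); last first.
  by rewrite sumr_const card_ord mulr_natl.
apply: ler_sum => i _; rewrite fnormZ.
have -> : fnorm (delta_mx 0 i : 'rV[R]_n) = 1.
  rewrite /fnorm innerE big_ord1 (bigD1 i) //= big1 ?addr0 ?mxE ?eqxx ?mulr1 ?sqrtr1 //.
  by move=> j ji; rewrite mxE eqxx (negbTE ji) mulr0.
rewrite mulr1 [leRHS]/Num.norm /= mx_normrE; apply/bigmax_geP; right => /=.
by exists (0, i).
Qed.

Lemma mx_norm_le_fnorm n (v : 'rV[R]_n) : `|v| <= fnorm v.
Proof.
rewrite [leLHS]/Num.norm /= mx_normrE; apply/bigmax_leP; split=> //= i _.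
exact: fnorm_entry.
Qed.

Lemma fnorm_vec_mx m n (v : 'rV[R]_(m * n)) :
  fnorm (vec_mx v : 'M[R]_(m, n)) = fnorm v.
Proof.
rewrite /fnorm !innerE big_ord1 pair_bigA /=; congr Num.sqrt.
rewrite [RHS](reindex (uncurry (@mxvec_index m n))) /=; last exact: curry_mxvec_bij.
by apply: eq_bigr => -[i j] _; rewrite !mxE.
Qed.

Lemma fnorm_lipschitz_continuous n (g : 'rV[R]_n -> R) C : 0 <= C ->
  (forall u v, `|g u - g v| <= C * fnorm (u - v)) -> continuous g.
Proof.
move=> C0 gC v; apply/(@cvgrPdist_le _ _ _ (nbhs v) (nbhs_filter v)) => e e0.
have c0 : 0 < C * n%:R + 1 by rewrite ltr_wpDl ?mulr_ge0.
have /(@cvgrPdist_le _ _ _ (nbhs v) (nbhs_filter v)) := @cvg_id _ (nbhs v).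
move=> /(_ _ (divr_gt0 e0 c0)); apply: filterS => u; rewrite ler_pdivlMr // mulrC; apply: le_trans.
rewrite mulrDl mul1r; apply: le_trans (gC _ _) _.
rewrite -[leLHS]addr0 lerD // -mulrA ler_wpM2l //; exact: fnorm_le_mx_norm.
Qed.

Variables (m n p : nat) (A : {linear 'M[R]_(m, n) -> 'cV[R]_p}) (b : 'cV[R]_p).

Lemma primal_objective_continuous l :
  continuous (fun v : 'rV[R]_(m * n) => primal_objective A b l (vec_mx v)).
Proof.
have vecB (u v : 'rV[R]_(m * n)) :
    fnorm (vec_mx u - vec_mx v : 'M[R]_(m, n)) = fnorm (u - v).
  by rewrite -linearB fnorm_vec_mx.
have [C C0 [AC _]] := adjoint_bounded A.
have cnuc : continuous (fun v : 'rV[R]_(m * n) => nuclear_norm (vec_mx v : 'M[R]_(m, n))).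
  apply: (@fnorm_lipschitz_continuous _ _ (Num.sqrt n%:R)) => [|u v].
    exact: sqrtr_ge0.
  by rewrite -vecB nuclear_norm_dist.
have cres : continuous (fun v : 'rV[R]_(m * n) => fnorm (A (vec_mx v) - b)).
  apply: (@fnorm_lipschitz_continuous _ _ C) => // u v.
  apply: le_trans (fnorm_dist _ _) _.
  by rewrite opprB addrA subrK -linearB -vecB AC.
move=> v; have Fv := nbhs_filter v.
apply: (@cvgD _ _ _ (nbhs v) Fv).
  by apply: (@cvgM _ _ (nbhs v) Fv); [exact: cvg_cst|exact: cnuc].
apply: (@cvgM _ _ (nbhs v) Fv); first exact: cvg_cst.
rewrite expr2; under eq_fun do rewrite expr2.
by apply: (@cvgM _ _ (nbhs v) Fv); exact: cres.
Qed.

(** Coercivity: the objective dominates [l * fnorm X], so its sublevel set at the value in 0 is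
    compact. *)
Lemma primal_argmin_exists l : 0 < l ->
  exists X, argmin setT (primal_objective A b l) X.
Proof.
move=> l0; pose f := primal_objective A b l.
have f_ge X : l * fnorm X <= f X.
  rewrite /f /primal_objective.
  apply: (@le_trans _ _ (l * nuclear_norm X)).
    by rewrite ler_pM2l // fnorm_le_nuclear_norm.
  by rewrite lerDl mulr_ge0 ?invr_ge0 // sqr_ge0.
pose K := [set v : 'rV[R]_(m * n) | f (vec_mx v) <= f 0].
have K0 : K 0 by rewrite /K /= linear0.
have cf : continuous (fun v : 'rV[R]_(m * n) => f (vec_mx v)).
  exact: primal_objective_continuous.
have cK : compact K.
  apply: bounded_closed_compact.
    exists (f 0 / l); split; first exact: num_real.
    move=> M fM v /= Kv; apply: le_trans (mx_norm_le_fnorm _) _.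
    apply: le_trans (ltW fM); rewrite ler_pdivlMr // mulrC.
    apply: le_trans Kv; apply: le_trans (f_ge _); rewrite ler_pM2l //.
    by rewrite fnorm_vec_mx.
  by apply: (@closed_comp _ _ _ [set x | x <= f 0]) => [v _|]; [exact: cf|exact: closed_le].
have [c cK' cmin] := @compact_EVT_min _ R (fun v => f (vec_mx v)) K
  (ex_intro _ 0 K0) cK (continuous_subspaceT cf).
move/set_mem: cK' => Kc.
exists (vec_mx c); split=> // X _; have [fX|fX] := leP (f X) (f 0).
  have := cmin (mxvec X); rewrite /= mxvecK; apply.
  by apply/mem_set; rewrite /K /= mxvecK.
by rewrite (le_trans Kc) // ltW.
Qed.

End Existence.

(** * Optimality conditions *)

Definition slack (R : realType) m n (l : R) (Z : 'M[R]_(m, n)) : 'M[R]_n :=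
  l ^+ 2 *: 1%:M - Z^T *m Z.

Section OptimalityConditions.
Variables (R : realType) (m n p : nat).
Variables (A : {linear 'M[R]_(m, n) -> 'cV[R]_p}) (b : 'cV[R]_p).

(* Optimality conditions of the dual problem, whose constraint is rewritten as
   [slack l Z >= 0] in the semidefinite order; [L] is the multiplier, and
   [X = Z *m L] is primal optimal. *)
Definition kkt (l : R) (y : 'cV[R]_p) (L : 'M[R]_n) : Prop :=
  [/\ psd L, psd (slack l (adjoint A y)), L *m slack l (adjoint A y) = 0
    & y = b - A (adjoint A y *m L)].

Lemma linear_le_quadratic_ge0 (a c : R) : 0 <= c ->
  (forall t, 0 < t <= 1 -> 0 <= t * a + t ^+ 2 * c) -> 0 <= a.
Proof.
move=> c0 h; rewrite leNgt; apply/negP => a0.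
have d0 : 0 < c - a + 1 by lra.
(* Chosen so that [a + t * c = - t * (1 - a)], which is negative. *)
pose t := - a / (c - a + 1).
have tE : t * (c - a + 1) = - a by rewrite /t divfK ?gt_eqF.
have t0 : 0 < t by rewrite divr_gt0 // oppr_gt0.
have t1 : t <= 1 by rewrite ler_pdivrMr //; lra.
have := h t; rewrite t0 t1 => /(_ isT).
have -> : t * a + t ^+ 2 * c = t * (a + t * c) by ring.
rewrite pmulr_rge0 // => ac; have : t * (1 - a) <= 0 by nra.
by rewrite leNgt mulr_gt0 //; lra.
Qed.

(** The nuclear norm is not differentiable, but convexity bounds its growth linearly along the
    segment to [X'], and the residual term is expanded exactly; only the terms of order [t]
    survive. *)
Lemma argmin_first_order l X X' : 0 < l ->
  argmin setT (primal_objective A b l) X ->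
  inner (b - A X) (A (X' - X)) <= l * (nuclear_norm X' - nuclear_norm X).
Proof.
move=> l0 [_ Xmin]; set D := X' - X; rewrite -subr_ge0.
apply: (@linear_le_quadratic_ge0 _ (2^-1 * fnorm (A D) ^+ 2)) => [|t /andP[t0 t1]].
  by rewrite mulr_ge0 ?invr_ge0 // sqr_ge0.
have := Xmin (X + t *: D) I; rewrite /primal_objective.
have nucD : nuclear_norm (X + t *: D)
    <= (1 - t) * nuclear_norm X + t * nuclear_norm X'.
  have -> : X + t *: D = (1 - t) *: X + t *: X'.
    by rewrite /D scalerBr scalerBl scale1r addrCA addrC -addrA [- _ + _]addrC.
  apply: le_trans (nuclear_normD _ _) _.
  by rewrite lerD // nuclear_normZ ?subr_ge0 // ltW.
have -> : A (X + t *: D) - b = - (b - A X) + t *: A D.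
  by rewrite linearD linearZ opprB addrAC.
rewrite -(fnormN (A X - b)) opprB; move: (b - A X) (A D) => r d.
rewrite !fnorm_sqr !inner_lin (innerC d); move: (ler_wpM2l (ltW l0) nucD).
move: (nuclear_norm _) (nuclear_norm _) (nuclear_norm _) => x1 x2 x3.
move: (inner _ _) (inner _ _) (inner _ _) => x4 x5 x6; lra.
Qed.

(** The multiplier is the polar factor [H] of [X] divided by [l]. Equality in the duality
    [inner Z X <= l * nuclear_norm X] forces [Z] and [l *: W] to agree on the range of [H], whence
    [Z *m L = X]. *)
Lemma argmin_kkt l X : 0 < l -> argmin setT (primal_objective A b l) X ->
  exists L, kkt l (b - A X) L.
Proof.
move=> l0 Xmin; set y := b - A X; set Z := adjoint A y.
have opt X' : inner Z (X' - X) <= l * (nuclear_norm X' - nuclear_norm X).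
  by rewrite innerC -adjointP innerC; exact: argmin_first_order.
(* Homogeneity: the subgradient inequality is tested at [X + X] and at 0. *)
have ZX : inner Z X = l * nuclear_norm X.
  apply/eqP; rewrite eq_le; apply/andP; split.
    have := opt (X + X); rewrite addrK => /le_trans; apply.
    by rewrite ler_pM2l // lerBlDr nuclear_normD.
  have := opt 0; rewrite sub0r nuclear_norm0 innerNr; lra.
have Zle M : inner Z M <= l * nuclear_norm M.
  have := opt (X + M); rewrite addrC addKr => /le_trans; apply.
  by rewrite ler_pM2l // lerBlDr addrC nuclear_normD.
(* Tested on rank-one matrices, [Zle] says that [Z] has operator norm at most [l]. *)
have Spsd : psd (slack l Z).
  apply/psdP; split=> [|v].
    by rewrite /slack [LHS]linearB /= linearZ /= trmx1 trmx_mul trmxK.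
  rewrite mulmxBl innerDr innerNr -scalemxAl mul1mx innerZr -mulmxA.
  rewrite -[Z in Z^T]trmxK trmxK -inner_mull -!fnorm_sqr -exprMn subr_ge0.
  rewrite lerXn2r ?nnegrE ?mulr_ge0 ?(ltW l0) //.
  have [->|Zv0] := eqVneq (fnorm (Z *m v)) 0; first by rewrite mulr_ge0 // ltW.
  have Zv : 0 < fnorm (Z *m v) by rewrite lt_def Zv0 /=.
  rewrite -(ler_pM2l Zv) -expr2 fnorm_sqr inner_mulr.
  apply: le_trans (Zle _) _; rewrite [leRHS]mulrCA ler_pM2l //.
  exact: nuclear_norm_outer.
have [H [W [Hpsd HH Wpsd XE WX]]] := polar_decomposition X.
have trH := nuclear_normE Hpsd HH.
have ZH : Z *m H = l *: X.
  pose D := Z - l *: W.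
  have D0 : inner (D *m H) D = 0.
    apply/eqP; rewrite eq_le weighted_inner_ge0 // andbT.
    have := weighted_inner_bound Hpsd Spsd.
    have := weighted_inner_bound Hpsd Wpsd; rewrite expr1n => hW hZ.
    rewrite /D mulmxBl -scalemxAl !inner_lin (weighted_innerC Z W) // -XE.
    by rewrite (innerC X Z) (innerC X W) ZX WX trH -XE in hW *; nra.
  have DH : D *m H = 0.
    apply: inner_eq0; rewrite inner_mull mulmxA.
    have : H *m (D^T *m D) = 0.
      by apply: psd_inner_eq0 => //; [exact: psd_gram|rewrite -inner_mull].
    move/(congr1 trmx); rewrite trmx_mul trmx_mul trmxK (psd_sym Hpsd) trmx0 => ->.
    by rewrite inner0r.
  by apply/eqP; rewrite -subr_eq0 {1}XE scalemxAl -mulmxBl DH.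
have ZL : Z *m (l^-1 *: H) = X.
  by rewrite -scalemxAr ZH scalerA mulVf ?gt_eqF // scale1r.
have Lpsd : psd (l^-1 *: H) by apply: psdZ => //; rewrite invr_ge0 ltW.
exists (l^-1 *: H); split=> //; last by rewrite ZL.
apply: psd_inner_eq0 => //; rewrite innerDr innerNr -inner_mull ZL innerC.
by rewrite inner_lin inner1l linearZ /= (innerC X) ZX trH; field; rewrite gt_eqF.
Qed.

Lemma kkt_inner l y L : kkt l y L ->
  inner (adjoint A y *m L) (adjoint A y) = l ^+ 2 * \tr L.
Proof.
move=> [Lpsd _ LS _]; have := congr1 mxtrace LS; rewrite mxtrace0 => LS0.
have : inner L (slack l (adjoint A y)) = 0 by rewrite /inner (psd_sym Lpsd).
rewrite innerDr innerNr innerZr (innerC L) inner1l -inner_mull; lra.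
Qed.

Lemma kkt_residual l y L : kkt l y L -> inner y (b - y) = l ^+ 2 * \tr L.
Proof.
move=> kktL; rewrite -(kkt_inner kktL); have [_ _ _ yE] := kktL.
by rewrite {2}yE opprB addrC subrK innerC adjointP.
Qed.

Lemma psd_trace_ge0 k (L : 'M[R]_k) : psd L -> 0 <= \tr L.
Proof. by move=> Lpsd; exact: le_trans (fnorm_ge0 _) (psd_fnorm_le_trace Lpsd). Qed.

Lemma kkt_fnorm_le l y L : kkt l y L -> fnorm y <= fnorm b.
Proof.
move=> kktL; have [Lpsd _ _ _] := kktL.
have : 0 <= inner y (b - y).
  by rewrite (kkt_residual kktL) mulr_ge0 ?sqr_ge0 // psd_trace_ge0.
rewrite innerDr innerNr subr_ge0 -fnorm_sqr => yb.
have [->//|y0] := eqVneq (fnorm y) 0.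
have yp : 0 < fnorm y by rewrite lt_def y0 /=.
by rewrite -(ler_pM2l yp) -expr2 (le_trans yb) // cauchy_schwarz.
Qed.

Lemma kkt_multiplier_le l y L : kkt l y L -> l ^+ 2 * fnorm L <= fnorm b ^+ 2.
Proof.
move=> kktL; have [Lpsd _ _ _] := kktL.
apply: (@le_trans _ _ (l ^+ 2 * \tr L)).
  by rewrite ler_wpM2l ?sqr_ge0 // psd_fnorm_le_trace.
rewrite -(kkt_residual kktL) innerDr innerNr -fnorm_sqr.
have := cauchy_schwarz y b; have := kkt_fnorm_le kktL.
have := fnorm_ge0 b; have := fnorm_ge0 y; nra.
Qed.

(** The inequality characterizing [y] as the projection of [b] onto the feasible set: its left side
    is a difference of inner products weighted by [L], to which the spectral bounds at [y] and [z]
    apply. *)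
Lemma kkt_variational l y L z : kkt l y L -> psd (slack l (adjoint A z)) ->
  inner (b - y) (z - y) <= 0.
Proof.
move=> kktL zfeas; have [Lpsd yfeas _ yE] := kktL.
rewrite {1}yE opprB addrC subrK adjointP adjointB innerDr innerNr.
rewrite (kkt_inner kktL).
have := weighted_inner_le (adjoint A y) (adjoint A z) Lpsd.
have := weighted_inner_bound Lpsd yfeas; have := weighted_inner_bound Lpsd zfeas.
lra.
Qed.

Lemma slackZ l c (Z : 'M[R]_(m, n)) : slack (c * l) (c *: Z) = c ^+ 2 *: slack l Z.
Proof.
rewrite /slack [(_ *: Z)^T]linearZ /= -scalemxAl -scalemxAr scalerBr !scalerA.
by rewrite -expr2 exprMn.
Qed.

(** Feasible sets for different parameters are homothetic, so [c *: y2] and [c^-1 *: y1] are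
    competitors in the two variational inequalities. The case [l1 = l2] is uniqueness of the dual
    solution. *)
Lemma kkt_lipschitz l1 l2 y1 y2 L1 L2 : 0 < l1 -> 0 < l2 ->
  kkt l1 y1 L1 -> kkt l2 y2 L2 ->
  fnorm (y1 - y2) <= 2 * fnorm b / l2 * `|l1 - l2|.
Proof.
move=> l1p l2p kkt1 kkt2; pose c := l1 / l2.
have [u uE] : {u | u = c *: y2} by exists (c *: y2).
have c0 : 0 < c by rewrite divr_gt0.
have c1 : c * l2 = l1 by rewrite /c divfK ?gt_eqF.
have c2 : c^-1 * l1 = l2 by rewrite -c1 mulKf ?gt_eqF.
have [[_ feas1 _ _] [_ feas2 _ _]] := (kkt1, kkt2).
have vi1 : inner (b - y1) (u - y1) <= 0.
  apply: (kkt_variational kkt1); rewrite uE adjointZ -{1}c1 slackZ.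
  by apply: psdZ => //; rewrite sqr_ge0.
have vi2 : inner (b - y2) (y1 - u) <= 0.
  have -> : y1 - u = c *: (c^-1 *: y1 - y2).
    by rewrite uE scalerBr scalerA mulfV ?gt_eqF // scale1r.
  rewrite innerZr pmulr_rle0 //; apply: (kkt_variational kkt2).
  by rewrite adjointZ -{1}c2 slackZ; apply: psdZ => //; rewrite sqr_ge0.
have uy : fnorm (u - y1) <= fnorm (u - y2).
  have [->//|uy0] := eqVneq (fnorm (u - y1)) 0.
  have uyp : 0 < fnorm (u - y1) by rewrite lt_def uy0 /=.
  rewrite -(ler_pM2l uyp) -expr2 fnorm_sqr.
  apply: le_trans (cauchy_schwarz _ _).
  move: vi1 vi2; rewrite !inner_lin (innerC y1 u) (innerC y2 u) (innerC y2 y1).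
  lra.
have uy2 : fnorm (u - y2) = `|l1 - l2| / l2 * fnorm y2.
  rewrite uE -{2}[y2]scale1r -scalerBl fnormZ; congr (_ * _).
  have -> : c - 1 = (l1 - l2) / l2 by rewrite mulrBl divff ?gt_eqF.
  by rewrite normrM normfV (gtr0_norm l2p).
have -> : y1 - y2 = (u - y2) - (u - y1) by rewrite opprB [RHS]addrC addrA subrK.
apply: le_trans (fnormB _ _) _.
apply: (@le_trans _ _ (2 * fnorm (u - y2))); first lra.
have h : `|l1 - l2| / l2 * fnorm y2 <= `|l1 - l2| / l2 * fnorm b.
  by rewrite ler_wpM2l ?(kkt_fnorm_le kkt2) // divr_ge0 // ltW.
rewrite uy2; lra.
Qed.

(** Existence of a minimizer keeps [xget] from falling back on a default that is not optimal; the
    residual of the selected minimizer solves the dual. *)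
Lemma primal_dual_solution l : 0 < l ->
  exists y L, kkt l y L /\ value_function A b l = fnorm y.
Proof.
move=> l0; have [X Xmin] := primal_argmin_exists A b l0.
rewrite /value_function; set X0 := xget _ _.
have X0min : argmin setT (primal_objective A b l) X0 by apply: xgetPex; exists X.
have [L kktL] := argmin_kkt l0 X0min.
by exists (b - A X0), L; split=> //; rewrite fnorm_sub.
Qed.

Lemma dual_solution_kkt l y : 0 < l -> dual_solution A b l y ->
  exists L, kkt l y L.
Proof.
move=> l0 [yfeas ymin]; have [y1 [L [kktL _]]] := primal_dual_solution l0.
exists L; suff -> : y = y1 by [].
have [_ feas1 _ _] := kktL.
have vi : inner (b - y1) (y - y1) <= 0.
  by apply: (kkt_variational kktL); apply/spectral_normP => //; exact: ltW.
have := ymin y1; rewrite /dual_objective !fnorm_sqr => /(_ _)/=.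
rewrite -/(epi_spectral _) => ymin1.
have {}ymin1 : 2^-1 * inner y y - inner b y <= 2^-1 * inner y1 y1 - inner b y1.
  by apply: ymin1; apply/spectral_normP => //; exact: ltW.
apply/eqP; rewrite -subr_eq0; apply/eqP/inner_eq0/eqP.
rewrite eq_le inner_ge0 andbT.
move: vi; rewrite !inner_lin (innerC y1 y); lra.
Qed.

End OptimalityConditions.

(** * Constraint nondegeneracy *)

Section Nondegeneracy.
Variables (R : realType) (m n p : nat).

(** A supporting hyperplane of the epigraph at [(l, Z)]: for [q] in the kernel of the slack, [Z]
    stretches [q] by exactly [l], so the difference of the two sides vanishes there. *)
Lemma epi_functional_le0 (l : R) (Z : 'M[R]_(m, n)) (q : 'cV[R]_n)
    (u : R^o * 'M[R]_(m, n)) :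
  0 <= l -> slack l Z *m q = 0 -> epi_spectral u ->
  inner (Z *m q) (u.2 *m q) <= l * u.1 * inner q q.
Proof.
case: u => t X l0 Sq /= Xt.
have le_norm r (Y : 'M[R]_(m, n)) : 0 <= r -> spectral_norm Y <= r ->
    fnorm (Y *m q) <= r * fnorm q.
  move=> r0 /(spectral_normP _ r0)/psdP[_ /(_ q)].
  rewrite mulmxBl -scalemxAl mul1mx innerDr innerNr innerZr -mulmxA.
  rewrite -[Y in Y^T]trmxK trmxK -inner_mull -!fnorm_sqr -exprMn subr_ge0.
  by rewrite ler_sqr ?nnegrE ?mulr_ge0.
have t0 : 0 <= t.
  apply: le_trans Xt; rewrite /spectral_norm; elim/big_rec: _ => // x y _ y0.
  by rewrite le_max y0 orbT.
have Zq : fnorm (Z *m q) <= l * fnorm q.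
  have := congr1 (inner q) Sq; rewrite inner0r mulmxBl -scalemxAl mul1mx.
  rewrite innerDr innerNr innerZr -mulmxA -[Z in Z^T]trmxK trmxK -inner_mull.
  rewrite -!fnorm_sqr -exprMn => /eqP; rewrite subr_eq0 => /eqP Zq.
  by rewrite -ler_sqr ?nnegrE ?mulr_ge0 // Zq.
apply: le_trans (cauchy_schwarz _ _) _; rewrite -fnorm_sqr.
have -> : l * t * fnorm q ^+ 2 = (l * fnorm q) * (t * fnorm q) by ring.
by rewrite ler_pM // le_norm.
Qed.

(** A supporting functional is nonpositive on tangent directions: along [t *: d] it exceeds its
    values on the epigraph by at most a multiple of the distance, which is [o(t)]. *)
Lemma tangent_epi_le0 (l : R) (Z : 'M[R]_(m, n)) (q : 'cV[R]_n)
    (d : R^o * 'M[R]_(m, n)) :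
  0 <= l -> slack l Z *m q = 0 ->
  tangent_cone (@product_norm R m n) (@epi_spectral R m n) (l, Z) d ->
  inner (Z *m q) (d.2 *m q) <= l * d.1 * inner q q.
Proof.
move=> l0 Sq /eqoP Td.
pose f (u : R^o * 'M[R]_(m, n)) := inner (Z *m q) (u.2 *m q) - l * u.1 * inner q q.
pose C := fnorm (Z *m q) * fnorm q + l * inner q q.
have C0 : 0 <= C by rewrite addr_ge0 ?mulr_ge0 ?inner_ge0.
have norm1 (u : R^o * 'M[R]_(m, n)) : `|u.1| <= product_norm u.
  by rewrite -sqrtr_sqr ler_wsqrtr // lerDl sqr_ge0.
have norm2 (u : R^o * 'M[R]_(m, n)) : fnorm u.2 <= product_norm u.
  rewrite -(ger0_norm (fnorm_ge0 _)) -sqrtr_sqr ler_wsqrtr //.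
  by rewrite lerDr sqr_ge0.
have f_le u : f u <= C * product_norm u.
  rewrite /f /C mulrDl; apply: lerD.
    apply: le_trans (cauchy_schwarz _ _) _; rewrite -mulrA ler_wpM2l //.
    by rewrite (le_trans (fnormM _ _)) // mulrC ler_wpM2l.
  rewrite -mulNr -mulrN -!mulrA ler_wpM2l // mulrC ler_wpM2l ?inner_ge0 //.
  by rewrite (le_trans _ (norm1 u)) // -normrN ler_norm.
have f0 : f (l, Z) = 0.
  have := congr1 (inner q) Sq; rewrite inner0r mulmxBl -scalemxAl mul1mx.
  rewrite innerDr innerNr innerZr -mulmxA -[Z in Z^T]trmxK trmxK -inner_mull /f /=.
  by rewrite expr2; lra.
suff fd e : 0 < e -> f d <= C * (2 * e).
  rewrite -subr_le0 -/(f d); apply/ler_addgt0Pr => e e0; rewrite add0r.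
  have e'0 : 0 < e / (2 * (C + 1)) by rewrite divr_gt0 // mulr_gt0 // ltr_wpDl.
  apply: le_trans (fd _ e'0) _.
  have -> : C * (2 * (e / (2 * (C + 1)))) = e * (C / (C + 1)).
    by field; rewrite gt_eqF // ltr_wpDl.
  rewrite ger_pMr // ler_pdivrMr ?ltr_wpDl //; lra.
move=> e0; have {}Td := Td _ e0.
have : \forall t \near 0^'+, 0 < t /\
   `|dist (@product_norm R m n) ((l, Z) + t *: d) (@epi_spectral R m n)| <= e * `|t|.
  by near=> t; split; near: t => //; exact: nbhs_right_gt.
case/filter_ex => t [t0 distt].
have : inf [set product_norm ((l, Z) + t *: d - z) | z in @epi_spectral R m n] < 2 * e * t.
  apply: le_lt_trans (ler_norm _) _; apply: le_lt_trans distt _.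
  by rewrite gtr0_norm // -mulrA mulr2n mulrDl mul1r ltrDl mulr_gt0.
move=> /inf_lt[|_ [z Kz <-] zd].
  pose z0 : R^o * 'M[R]_(m, n) := (spectral_norm (0 : 'M[R]_(m, n)), 0).
  by exists (product_norm ((l, Z) + t *: d - z0)); exists z0 => //; exact: lexx.
have fz : f z <= 0 by rewrite subr_le0; exact: epi_functional_le0.
have fE : t * f d = f ((l, Z) + t *: d - z) + f z - f (l, Z).
  rewrite /f /= !mulmxDl mulNmx -scalemxAl !inner_lin.
  rewrite -[t *: d.1]/(t * d.1); ring.
rewrite -(ler_pM2l t0) fE f0 subr0.
have := f_le ((l, Z) + t *: d - z).
have : C * product_norm ((l, Z) + t *: d - z) <= C * (2 * e * t).
  by rewrite ler_wpM2l // ltW.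
lra.
Unshelve. all: by end_near. Qed.

Lemma lin_tangent_epi (l : R) (Z : 'M[R]_(m, n)) (q : 'cV[R]_n)
    (d : R^o * 'M[R]_(m, n)) :
  0 <= l -> slack l Z *m q = 0 ->
  lin (tangent_cone (@product_norm R m n) (@epi_spectral R m n) (l, Z)) d ->
  inner (Z *m q) (d.2 *m q) = l * d.1 * inner q q.
Proof.
move=> l0 Sq [Td [d' Td' d'E]]; apply/eqP; rewrite eq_le tangent_epi_le0 //=.
have := tangent_epi_le0 l0 Sq Td'; rewrite -d'E /= mulNmx innerNr; lra.
Qed.

Lemma inner_spectral n' (U : 'M[R]_n') (d : 'rV[R]_n') (B : 'M[R]_n') :
  inner (U *m diag_mx d *m U^T) B = \sum_i d 0 i * inner (col i U) (B *m col i U).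
Proof.
rewrite inner_mulr trmxK inner_mull innerE; apply: eq_bigr => i _.
rewrite (bigD1 i) //= big1 ?addr0 => [|j ji]; last first.
  by rewrite mxE eq_sym (negbTE ji) mul0r.
rewrite mxE eqxx mulr1n; congr (_ * _).
rewrite innerE mxE; apply: eq_bigr => k _; rewrite big_ord1 !mxE; congr (_ * _).
by apply: eq_bigr => j _; rewrite mxE.
Qed.

Variable A : {linear 'M[R]_(m, n) -> 'cV[R]_p}.

(** Nondegeneracy splits [(0, Z *m N)] into a range part and a lineality direction [(0, D)].
    Eigenvectors of [N] with nonzero eigenvalue lie in the kernel of the slack, so [D] is orthogonal
    to [Z *m N]; so is the range part, since [A (Z *m N) = 0]. Hence [Z *m N = 0], and the slack
    acts on [N] as [l ^+ 2]. *)
Lemma nondegenerate_injective l y (N : 'M[R]_n) : 0 < l ->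
  constraint_nondegenerate A l y -> N^T = N ->
  slack l (adjoint A y) *m N = 0 -> A (adjoint A y *m N) = 0 -> N = 0.
Proof.
set Z := adjoint A y; move=> l0 nondeg Nsym SN AZN.
have : [set: R^o * 'M[R]_(m, n)] (0, Z *m N) by [].
rewrite -nondeg => -[_ [z _ <-]] [[d1 D] lind /pair_equal_spec[]] /=.
rewrite add0r => d10 DE.
have [U [d [UU NE]]] := symmetric_spectral Nsym.
have ZN0 : inner (Z *m N) D = 0.
  rewrite inner_mull NE inner_spectral big1 // => i _.
  have [->|di] := eqVneq (d 0 i) 0; first by rewrite mul0r.
  have Sq : slack l Z *m col i U = 0.
    apply: (scalerI di); rewrite scaler0 scalemxAr -diag_mul_col // -NE.
    by rewrite mulmxA SN mul0mx.
  have := lin_tangent_epi (ltW l0) Sq lind; rewrite /= d10 mulr0 mul0r.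
  by rewrite inner_mull mulmxA => ->; rewrite mulr0.
have : inner (Z *m N) (Z *m N) = 0.
  by rewrite -{2}DE innerDr ZN0 addr0 -adjointP AZN inner0l.
move/inner_eq0 => ZN; move: SN.
rewrite mulmxBl -mulmxA ZN mulmx0 subr0 -scalemxAl mul1mx => /eqP.
by rewrite scaler_eq0 sqrf_eq0 (gt_eqF l0) => /eqP.
Qed.

Lemma row_inj_unitmx k (M : 'M[R]_k) :
  (forall v : 'rV[R]_k, v *m M = 0 -> v = 0) -> M \in unitmx.
Proof.
move=> Minj; rewrite -row_free_unit -kermx_eq0; apply/eqP/row_matrixP => i.
by rewrite row0; apply: Minj; rewrite -row_mul mulmx_ker row0.
Qed.

(** Injectivity becomes a bound in finite dimension. The third map, [N - N^T], encodes symmetry as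
    an equation, so that the sum of the three Gram matrices is invertible; its inverse supplies the
    constant. *)
Lemma nondegenerate_bound l y : 0 < l -> constraint_nondegenerate A l y ->
  exists2 C, 0 <= C & forall N : 'M[R]_n, N^T = N ->
    fnorm N <= C * (fnorm (slack l (adjoint A y) *m N) + fnorm (A (adjoint A y *m N))).
Proof.
move=> l0 nondeg; set Z := adjoint A y; set S := slack l Z.
pose G1 := lin_mx (mulmx S : 'M[R]_n -> 'M[R]_n).
pose G2 := lin_mx (A \o mulmx Z : 'M[R]_n -> 'cV[R]_p).
pose G3 := lin_mx (idfun \- trmx : 'M[R]_n -> 'M[R]_n).
pose M := G1 *m G1^T + G2 *m G2^T + G3 *m G3^T.
have Munit : M \in unitmx.
  apply: row_inj_unitmx => v vM; pose N := vec_mx v : 'M[R]_n.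
  have vE : v = mxvec N by rewrite vec_mxK.
  have := congr1 (fun w => inner w v) vM; rewrite inner0l !mulmxDr !innerDl.
  have sqE k (G : 'M[R]_(_, k)) : inner (v *m (G *m G^T)) v = inner (v *m G) (v *m G).
    by rewrite mulmxA inner_mulr trmxK.
  rewrite !sqE => sum0.
  have := inner_ge0 (v *m G1); have := inner_ge0 (v *m G2).
  have := inner_ge0 (v *m G3) => h3 h2 h1.
  have : v *m G1 = 0 by apply: inner_eq0; lra.
  have : v *m G2 = 0 by apply: inner_eq0; lra.
  have : v *m G3 = 0 by apply: inner_eq0; lra.
  rewrite vE !mul_vec_lin => /eqP; rewrite mxvec_eq0 subr_eq0 => /eqP /= Nsym.
  move=> /eqP; rewrite mxvec_eq0 => /eqP /= AZN.
  move=> /eqP; rewrite mxvec_eq0 => /eqP /= SN.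
  by rewrite (nondegenerate_injective l0 nondeg (esym Nsym) SN AZN) linear0.
have fnorm_mxvec a c (X : 'M[R]_(a, c)) : fnorm (mxvec X) = fnorm X.
  by rewrite -fnorm_vec_mx mxvecK.
pose C := fnorm (G1^T *m invmx M) + fnorm (G2^T *m invmx M).
exists C => [|N Nsym]; first by rewrite addr_ge0.
rewrite -fnorm_mxvec -[mxvec N](mulmxK Munit) !mulmxDr !mulmxA !mul_vec_lin /=.
rewrite Nsym subrr linear0 mul0mx addr0 mulmxDl -!mulmxA.
apply: le_trans (fnormD _ _) _.
apply: le_trans (lerD (fnormM _ _) (fnormM _ _)) _; rewrite !fnorm_mxvec.
rewrite /C; set a := fnorm (S *m N); set c := fnorm (A _).
have := fnorm_ge0 (G1^T *m invmx M); have := fnorm_ge0 (G2^T *m invmx M).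
have : 0 <= a := fnorm_ge0 _; have : 0 <= c := fnorm_ge0 _.
move: (fnorm (G1^T *m _)) (fnorm (G2^T *m _)) => g h; nra.
Qed.

End Nondegeneracy.

(** * Stability of solutions *)

Section Stability.
Variables (R : realType) (m n p : nat).
Variables (A : {linear 'M[R]_(m, n) -> 'cV[R]_p}) (b : 'cV[R]_p).

(** Monotonicity of the optimality system. Weighted inner products reduce the cross terms to half of
    [inner (slack l Zh - slack l Z) (L - Lh)], and exact complementarity of both pairs makes
    [inner (Sh - slack l Z) (L - Lh)] nonnegative; only the two residuals are left. *)
Lemma energy_estimate l y L yh (Lh Sh : 'M[R]_n) :
  kkt A b l y L -> psd Lh -> psd Sh -> Lh *m Sh = 0 ->
  fnorm (y - yh) ^+ 2 <=
    2^-1 * inner (Sh - slack l (adjoint A yh)) (L - Lh)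
    - inner (y - yh) (yh - b + A (adjoint A yh *m Lh)).
Proof.
move=> kktL Lhpsd Shpsd LhSh; have [Lpsd Spsd LS yE] := kktL.
set Z := adjoint A y; set Zh := adjoint A yh.
have -> : inner (y - yh) (yh - b + A (Zh *m Lh)) =
    - inner (y - yh) (y - yh) - inner (Z - Zh) (Z *m L - Zh *m Lh).
  have -> : yh - b + A (Zh *m Lh) = - (y - yh) - A (Z *m L - Zh *m Lh).
    by rewrite [in RHS]yE [A (_ - _)]linearB -/Z; apply/colP => i; rewrite !mxE; ring.
  by rewrite [LHS]innerDr !innerNr (innerC _ (A _)) adjointP adjointB (innerC (Z - Zh)).
rewrite fnorm_sqr !inner_lin.
have hZL := weighted_inner_le Z Zh Lpsd.
have hZh := weighted_inner_le Zh Z Lhpsd.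
have gramE (H : 'M[R]_n) (X : 'M[R]_(m, n)) :
    inner (X *m H) X = l ^+ 2 * \tr H - inner (slack l X) H.
  by rewrite inner_mull /slack innerDl innerNl innerZl inner1l (innerC H); ring.
have LhSh0 : inner Sh Lh = 0.
  by rewrite innerC /inner (psd_sym Lhpsd) LhSh mxtrace0.
have SL0 : inner (slack l Z) L = 0.
  by rewrite innerC /inner (psd_sym Lpsd) LS mxtrace0.
have := psd_inner_ge0 Shpsd Lpsd; have := psd_inner_ge0 Spsd Lhpsd; rewrite -/Z.
rewrite LhSh0 (innerC Z) (innerC Zh) (innerC Z (Zh *m _)) (innerC Zh (Zh *m _)).
have slackI H : inner (slack l Zh) H = l ^+ 2 * inner 1%:M H - inner (Zh^T *m Zh) H.
  by rewrite /slack innerDl innerNl innerZl.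
move: hZL hZh; rewrite !gramE SL0 !slackI; lra.
Qed.

Lemma quadratic_bound (d e K : R) : 0 <= d -> 0 <= e -> 0 <= K ->
  d ^+ 2 <= 2^-1 * K * e * (d + e) + d * e -> d <= (K + 2) * e.
Proof.
move=> d0 e0 K0 h; rewrite leNgt; apply/negP => dK.
have Ke : 0 <= K * e by rewrite mulr_ge0.
have d1 : 0 < d by nra.
have ed : 2 * e <= d by nra.
have : d * (d - (2^-1 * K * e + e)) <= 2^-1 * K * e * e by nra.
have : d * (2^-1 * K * e) < d * (d - (2^-1 * K * e + e)) by rewrite ltr_pM2l //; nra.
nra.
Qed.

Lemma energy_arith (d e K e1 e2 x : R) : 0 <= d -> 0 <= K -> 0 <= e1 -> 0 <= e2 ->
  0 <= x -> e = e1 + e2 -> x <= K * (d + e) ->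
  d ^+ 2 <= 2^-1 * (e2 * x) + d * e1 -> d <= (K + 2) * e.
Proof.
move=> d0 K0 e10 e20 x0 eE xK h; have e0 : 0 <= e by rewrite eE addr_ge0.
apply: quadratic_bound => //; apply: le_trans h _.
have xe : e2 * x <= e * (K * (d + e)) by rewrite ler_pM // eE lerDr.
have de : d * e1 <= d * e by rewrite ler_wpM2l // eE lerDl.
lra.
Qed.

Lemma le_stability_constant (K e : R) : 0 <= K -> 0 <= e ->
  (K + 2) * e <= (K + 2) * (K + 3) * e.
Proof. by move=> K0 e0; rewrite ler_wpM2r // ler_peMr; lra. Qed.

Lemma multiplier_le_stability_constant (K e d : R) : 0 <= K -> 0 <= e -> d <= (K + 2) * e ->
  K * (d + e) <= (K + 2) * (K + 3) * e.
Proof.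
move=> K0 e0 dK; have : K * (d + e) <= K * ((K + 2) * e + e) by rewrite ler_wpM2l // lerD.
by have := mulr_ge0 K0 e0; lra.
Qed.

(** Here [x] is the multiplier error and [M] bounds the multiplier. The terms in [d0 * x] come from
    replacing the base point by the approximate one; for small [d0] they amount to at most [x / 2]
    and are absorbed on the left. *)
Lemma multiplier_arith (a B M C0 d0 d e1 e2 x : R) :
  0 <= a -> 0 <= M -> 0 <= C0 -> 0 <= d -> 0 <= e1 -> 0 <= e2 -> 0 <= x ->
  0 <= a * (2 * B) * a * M -> 0 <= a * a * M ->
  2 * (C0 * (1 + a * a) * d0) <= 1 ->
  x <= C0 * ((e2 + a * (2 * B) * a * d) * M + d0 * x
             + (d + e1 + a * (a * d * M) + a * (a * d0 * x))) ->
  x <= 2 * C0 * (M + a * (2 * B) * a * M + 1 + a * a * M) * (d + (e1 + e2)).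
Proof.
move=> a0 M0 C00 d_ge0 e10 e20 x0 q0 r0 C0d0 h.
have hx : 2 * (C0 * (1 + a * a) * d0) * x <= x by rewrite -[leRHS]mul1r ler_wpM2r.
have {h}hx : x <= 2 * C0 * (M * e2 + a * (2 * B) * a * M * d + d + e1 + a * a * M * d).
  by lra.
apply: le_trans hx _; rewrite -[leRHS]mulrA ler_wpM2l ?mulr_ge0 //.
move: (a * (2 * B) * a * M) (a * a * M) q0 r0 => q r q0 r0.
have := mulr_ge0 q0 e10; have := mulr_ge0 q0 e20.
have := mulr_ge0 r0 e10; have := mulr_ge0 r0 e20.
have := mulr_ge0 M0 d_ge0; have := mulr_ge0 M0 e10; lra.
Qed.

Lemma gram_dist (X Y : 'M[R]_(m, n)) :
  fnorm (X^T *m X - Y^T *m Y) <= (fnorm X + fnorm Y) * fnorm (X - Y).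
Proof.
have -> : X^T *m X - Y^T *m Y = X^T *m (X - Y) + (X - Y)^T *m Y.
  by rewrite mulmxBr [(X - Y)^T]linearB mulmxBl addrA subrK.
apply: le_trans (fnormD _ _) _; rewrite mulrDl lerD //.
  by rewrite (le_trans (fnormM _ _)) // fnormT.
by rewrite (le_trans (fnormM _ _)) // fnormT mulrC.
Qed.

(** Two estimates feed each other: nondegeneracy bounds the multiplier error by [K * (d + e)], and
    the energy estimate bounds [d ^+ 2] by [e] times half the multiplier error plus [d * e]. *)
Lemma kkt_stability l0 y0 : 0 < l0 -> constraint_nondegenerate A l0 y0 ->
  exists C d : R, [/\ 0 <= C, 0 < d & forall l y L yh (Lh Sh : 'M[R]_n),
    l0 / 2 <= l -> kkt A b l y L -> psd Lh -> psd Sh -> Lh *m Sh = 0 ->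
    fnorm (Sh - slack l0 (adjoint A y0)) <= d -> fnorm (yh - y0) <= d ->
    let e := fnorm (yh - b + A (adjoint A yh *m Lh))
             + fnorm (Sh - slack l (adjoint A yh)) in
    fnorm (y - yh) <= C * e /\ fnorm (L - Lh) <= C * e].
Proof.
move=> l0p nondeg; have [C0 C00 C0P] := nondegenerate_bound l0p nondeg.
have [a a0 [Aa A'a]] := adjoint_bounded A.
set Z0 := adjoint A y0 in C0P *; set S0 := slack l0 Z0 in C0P *.
(* Bounds both [fnorm y], through [b], and [fnorm yh], since [d0 <= 1]. *)
pose B := fnorm b + fnorm y0 + 1.
have B1 : 1 <= B by rewrite /B lerDr addr_ge0.
(* The factor 4 comes from [l0 / 2 <= l] in the a priori multiplier bound. *)
pose M := 4 * fnorm b ^+ 2 / l0 ^+ 2.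
have M0 : 0 <= M by rewrite divr_ge0 ?sqr_ge0 // mulr_ge0 // sqr_ge0.
pose K := 2 * C0 * (M + a * (2 * B) * a * M + 1 + a * a * M).
have B0 : 0 <= B := le_trans ler01 B1.
have q0 : 0 <= a * (2 * B) * a * M by do 3![apply: mulr_ge0 => //]; rewrite mulr_ge0.
have r0 : 0 <= a * a * M by do 2![apply: mulr_ge0 => //].
have K0 : 0 <= K.
  apply: mulr_ge0; first exact: mulr_ge0.
  by rewrite addr_ge0 // addr_ge0 // addr_ge0.
(* Small enough for the absorption in [multiplier_arith]; the added 1 ensures [d0 <= 1]. *)
pose d0 := (2 * C0 * (1 + a * a) + 1)^-1.
have D1 : 1 <= 2 * C0 * (1 + a * a) + 1.
  rewrite lerDr; apply: mulr_ge0; first exact: mulr_ge0.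
  by rewrite addr_ge0 // mulr_ge0.
have d0p : 0 < d0 by rewrite invr_gt0 (lt_le_trans ltr01).
have d01 : d0 <= 1 by rewrite invf_le1 // (lt_le_trans ltr01).
have C0d0 : 2 * (C0 * (1 + a * a) * d0) <= 1.
  rewrite !mulrA ler_pdivrMr ?(lt_le_trans ltr01) // mul1r -!mulrA; lra.
exists ((K + 2) * (K + 3)), d0; split => //.
  by rewrite mulr_ge0 // addr_ge0.
move=> l y L yh Lh Sh ll kktL Lhpsd Shpsd LhSh ShS0 yhy0 /=.
have [Lpsd Spsd LS yE] := kktL.
have energy := energy_estimate yh kktL Lhpsd Shpsd LhSh; move: energy.
set Z := adjoint A y in Spsd LS yE *; set Zh := adjoint A yh.
set e1 := yh - b + _; set e2 := Sh - _; set N := L - Lh; set e := fnorm e1 + fnorm e2.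
move=> energy; set d := fnorm (y - yh) in energy *.
have d_ge0 : 0 <= d := fnorm_ge0 _.
have [e1_ge0 e2_ge0] : 0 <= fnorm e1 /\ 0 <= fnorm e2 by split.
have e_ge0 : 0 <= e by rewrite addr_ge0.
have n_ge0 : 0 <= fnorm N by [].
have LM : fnorm L <= M.
  have := kkt_multiplier_le kktL.
  have l2 : l0 ^+ 2 <= 4 * l ^+ 2 by nra.
  rewrite ler_pdivlMr ?exprn_gt0 // => h; have : 0 <= fnorm L by [].
  by move=> L0; rewrite mulrC; apply: le_trans (ler_wpM2r L0 l2) _; lra.
have ZB : fnorm Z <= a * B.
  apply: le_trans (A'a _) _; rewrite ler_wpM2l // (le_trans (kkt_fnorm_le kktL)) //.
  by rewrite /B -addrA lerDl addr_ge0.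
have ZhB : fnorm Zh <= a * B.
  apply: le_trans (A'a _) _; rewrite ler_wpM2l // -[yh](subrK y0).
  apply: le_trans (fnormD _ _) _; rewrite /B -addrA addrC -lerBlDl.
  by have : 0 <= fnorm b by []; lra.
have ZZh : fnorm (Z - Zh) <= a * d by rewrite -adjointB A'a.
have ZhZ0 : fnorm (Zh - Z0) <= a * d0.
  by rewrite -adjointB; apply: le_trans (A'a _) _; rewrite ler_wpM2l.
have Nsym : N^T = N by rewrite linearB /= (psd_sym Lpsd) (psd_sym Lhpsd).
have boundS : fnorm (S0 *m N) <= (fnorm e2 + a * (2 * B) * a * d) * M + d0 * fnorm N.
  have SL : slack l Z *m L = 0.
    by apply: trmx_inj; rewrite trmx_mul (psd_sym Lpsd) (psd_sym Spsd) LS trmx0.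
  have ShLh : Sh *m Lh = 0.
    by apply: trmx_inj; rewrite trmx_mul (psd_sym Lhpsd) (psd_sym Shpsd) LhSh trmx0.
  (* As [slack l Z *m L] and [Sh *m Lh] vanish, only the residual, the change of [Z] and a small
     multiple of [N] remain. *)
  have -> : S0 *m N = (e2 + (Z^T *m Z - Zh^T *m Zh)) *m L - (Sh - S0) *m N.
    have -> : e2 + (Z^T *m Z - Zh^T *m Zh) = Sh - slack l Z.
      by apply/matrixP => i j; rewrite /e2 /slack -/Zh !mxE; ring.
    have ShN : Sh *m N = Sh *m L by rewrite [LHS]mulmxBr ShLh subr0.
    rewrite [(Sh - slack l Z) *m L]mulmxBl SL subr0 [(Sh - S0) *m N]mulmxBl ShN.
    by rewrite opprB addrCA subrr addr0.
  apply: le_trans (fnormB _ _) _; apply: lerD; last first.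
    by apply: le_trans (fnormM _ _) _; rewrite ler_wpM2r.
  apply: le_trans (fnormM _ _) _; apply: ler_pM => //.
  apply: le_trans (fnormD _ _) _; rewrite lerD //.
  apply: le_trans (gram_dist _ _) _.
  have -> : a * (2 * B) * a * d = (a * B + a * B) * (a * d) by ring.
  by rewrite ler_pM ?addr_ge0 // lerD.
have boundA : fnorm (A (Z0 *m N)) <= d + fnorm e1 + a * (a * d * M) + a * (a * d0 * fnorm N).
  have -> : A (Z0 *m N) = - (y - yh) - e1 - A ((Z - Zh) *m L) - A ((Zh - Z0) *m N).
    have -> : Z0 *m N = Z *m L - Zh *m Lh - (Z - Zh) *m L - (Zh - Z0) *m N.
      rewrite [(Z - Zh) *m L]mulmxBl [(Zh - Z0) *m N]mulmxBl [Zh *m N]mulmxBr.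
      move: (Z *m L) (Zh *m L) (Zh *m Lh) (Z0 *m N) => X1 X2 X3 X4.
      by apply/matrixP => i j; rewrite !mxE; ring.
    have AZL : A (Z *m L) = b - y by rewrite [in RHS]yE subKr.
    rewrite 3![A (_ - _)]linearB /= AZL /e1.
    move: (A _) (A _) (A _) => u1 u2 u3.
    by apply/matrixP => i j; rewrite !mxE; ring.
  apply: le_trans (fnormB _ _) _; apply: lerD; last first.
    apply: le_trans (Aa _) _; rewrite ler_wpM2l //.
    by apply: le_trans (fnormM _ _) _; rewrite ler_wpM2r.
  apply: le_trans (fnormB _ _) _; apply: lerD; last first.
    apply: le_trans (Aa _) _; rewrite ler_wpM2l //.
    by apply: le_trans (fnormM _ _) _; rewrite ler_pM.
  by apply: le_trans (fnormB _ _) _; rewrite fnormN.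
have nK : fnorm N <= K * (d + e).
  apply: (@multiplier_arith a B M C0 d0) => //.
  by apply: le_trans (C0P N Nsym) _; rewrite ler_wpM2l // lerD.
have dK : d <= (K + 2) * e.
  apply: (@energy_arith _ _ K (fnorm e1) (fnorm e2) (fnorm N)) => //.
  apply: le_trans energy _; apply: lerD.
    by rewrite ler_pM2l ?invr_gt0 // cauchy_schwarz.
  by rewrite -innerNl; apply: le_trans (cauchy_schwarz _ _) _; rewrite fnormN.
split; first exact: le_trans dK (le_stability_constant K0 e_ge0).
exact: le_trans nK (multiplier_le_stability_constant K0 e_ge0 dK).
Qed.

End Stability.

(** * Paths of complementary pairs *)

(* [r] plays the role of the small parameter: f = O(r^k) uniformly on D. *)
Definition bigOh (R : realType) (I : Type) (D : set I) (r : I -> R) (k : nat)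
    m n (f : I -> 'M[R]_(m, n)) : Prop :=
  exists2 C, 0 <= C & forall i, D i -> fnorm (f i) <= C * r i ^+ k.

Section BigOh.
Variables (R : realType) (I : Type) (D : set I) (r : I -> R).
Hypothesis r01 : forall i, D i -> 0 <= r i <= 1.

Local Notation O := (bigOh D r).

Lemma bigOh_weak j k m n (f : I -> 'M[R]_(m, n)) : (j <= k)%N -> O k f -> O j f.
Proof.
move=> jk [C C0 fC]; exists C => // i Di; apply: le_trans (fC i Di) _.
by rewrite ler_wpM2l // ler_wiXn2l //; case/andP: (r01 Di).
Qed.

Lemma bigOh_sub (D' : set I) k m n (f : I -> 'M[R]_(m, n)) :
  D' `<=` D -> O k f -> bigOh D' r k f.
Proof. by move=> D'D [C C0 fC]; exists C => // i /D'D; exact: fC. Qed.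

Lemma bigOh_ext k m n (f g : I -> 'M[R]_(m, n)) :
  (forall i, D i -> f i = g i) -> O k g -> O k f.
Proof. by move=> fg [C C0 gC]; exists C => // i Di; rewrite fg // gC. Qed.

Lemma bigOhD k m n (f g : I -> 'M[R]_(m, n)) :
  O k f -> O k g -> O k (fun i => f i + g i).
Proof.
move=> [C C0 fC] [C' C'0 gC]; exists (C + C') => [|i Di]; first exact: addr_ge0.
by apply: le_trans (fnormD _ _) _; rewrite mulrDl lerD ?fC ?gC.
Qed.

Lemma bigOhN k m n (f : I -> 'M[R]_(m, n)) : O k f -> O k (fun i => - f i).
Proof. by move=> [C C0 fC]; exists C => // i Di; rewrite fnormN fC. Qed.

Lemma bigOhB k m n (f g : I -> 'M[R]_(m, n)) :
  O k f -> O k g -> O k (fun i => f i - g i).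
Proof. by move=> fk gk; apply: bigOhD => //; exact: bigOhN. Qed.

Lemma bigOhT k m n (f : I -> 'M[R]_(m, n)) : O k f -> O k (fun i => (f i)^T).
Proof. by move=> [C C0 fC]; exists C => // i Di; rewrite fnormT fC. Qed.

Lemma bigOhM j k d m n q (f : I -> 'M[R]_(m, n)) (g : I -> 'M[R]_(n, q)) :
  (d <= j + k)%N -> O j f -> O k g -> O d (fun i => f i *m g i).
Proof.
move=> djk [C C0 fC] [C' C'0 gC]; apply: (bigOh_weak djk).
exists (C * C') => [|i Di]; first exact: mulr_ge0.
apply: le_trans (fnormM _ _) _; rewrite exprD mulrACA.
by rewrite ler_pM ?fC ?gC.
Qed.

Lemma bigOhZ k m n (c : I -> R) (f : I -> 'M[R]_(m, n)) :
  (forall i, D i -> `|c i| <= 1) -> O k f -> O k (fun i => c i *: f i).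
Proof.
move=> c1 [C C0 fC]; exists C => // i Di; rewrite fnormZ.
by rewrite -[leRHS]mul1r ler_pM // ?c1 // fC.
Qed.

Lemma bigOh_cst m n (X : 'M[R]_(m, n)) : O 0 (fun=> X).
Proof. by exists (fnorm X) => // i _; rewrite mulr1. Qed.

Lemma bigOh_linear k m n p q (A : {linear 'M[R]_(m, n) -> 'M[R]_(p, q)})
    (f : I -> 'M[R]_(m, n)) : O k f -> O k (fun i => A (f i)).
Proof.
move=> [C C0 fC]; have [a a0 Aa] := linear_bounded A.
exists (a * C) => [|i Di]; first exact: mulr_ge0.
by apply: le_trans (Aa _) _; rewrite -mulrA ler_wpM2l // fC.
Qed.

End BigOh.

(** * Congruences of interpolated semidefinite matrices *)

Section Congruence.
Variable R : realType.

(** For [D] and [M] of first order, [E] is the only part not automatically of second order; [M] has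
    to be chosen to make it so. *)
Definition congr_remainder n e (G0 D J M : 'M[R]_n) : 'M[R]_n :=
  let G := G0 + D in let W := G *m J *m G - G in let E := M *m G0 + D *m J *m G0 in
  D *m J *m D + (E + E^T) + (M *m D + D *m M^T) + e *: (M *m W + W *m M^T)
  + e *: (M *m (G + e *: W) *m M^T).

(** Since [G0 *m J *m G0 = G0], interpolating towards [G *m J *m G] moves [G] by [- e *: D] plus [e]
    times the cross term [D *m J *m G0] and its transpose, up to second order; the congruence is
    there to cancel these. *)
Lemma congr_expansion n e (G0 D J M : 'M[R]_n) :
  G0^T = G0 -> D^T = D -> J^T = J -> G0 *m J *m G0 = G0 ->
  let G := G0 + D in
  (1%:M + e *: M) *m ((1 - e) *: G + e *: (G *m J *m G)) *m (1%:M + e *: M)^T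
  = G - e *: D + e *: congr_remainder e G0 D J M.
Proof.
move=> G0sym Dsym Jsym G0JG0 G.
have WE : G *m J *m G - G = D *m J *m G0 + G0 *m J *m D + D *m J *m D - D.
  rewrite /G !mulmxDl !mulmxDr G0JG0.
  by apply/matrixP => i j; rewrite !mxE; ring.
have -> : (1 - e) *: G + e *: (G *m J *m G) = G + e *: (G *m J *m G - G).
  by apply/matrixP => i j; rewrite !mxE; ring.
rewrite /congr_remainder -/G; have [W WW] : {W | W = G *m J *m G - G} by eexists.
rewrite -WW; rewrite WE in WW.
have ET : (M *m G0 + D *m J *m G0)^T = G0 *m M^T + G0 *m J *m D.
  by rewrite linearD /= !trmx_mul G0sym Dsym Jsym mulmxA.
rewrite ET [(1%:M + _)^T]linearD /= [(e *: M)^T]linearZ /= trmx1.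
have expand (X Y T : 'M[R]_n) :
   (1%:M + X) *m T *m (1%:M + Y) = T + X *m T + T *m Y + X *m T *m Y.
  by rewrite mulmxDl mul1mx mulmxDr mulmx1 mulmxDl addrA.
rewrite expand -!(scalemxAl, scalemxAr) !(mulmxDl, mulmxDr) -!(scalemxAl, scalemxAr).
rewrite /G.
have WE' i j : W i j = (D *m J *m G0) i j + (G0 *m J *m D) i j + (D *m J *m D) i j - D i j.
  by rewrite WW !mxE.
apply/matrixP => i j; move: (WE' i j).
move: (D *m J *m G0) (G0 *m J *m D) (D *m J *m D) => X1 X2 X3.
move: (M *m G0) (M *m D) (M *m W) => X4 X5 X6.
move: (G0 *m M^T) (D *m M^T) (W *m M^T) (X4 *m M^T) (X5 *m M^T) (X6 *m M^T).
by move=> X7 X8 X9 X10 X11 X12; rewrite !mxE => ->; ring.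
Qed.

Lemma psd_interp n e (G J : 'M[R]_n) : 0 <= e <= 1 -> psd G -> psd J ->
  psd ((1 - e) *: G + e *: (G *m J *m G)).
Proof.
move=> /andP[e0 e1] Gpsd Jpsd; apply: psdD; apply: psdZ; rewrite ?subr_ge0 //.
by rewrite -{2}(psd_sym Gpsd); apply: psd_congr.
Qed.

Lemma bigOh_congr_remainder (I : Type) (Dm : set I) (r : I -> R) n
    (e : I -> R) (G0 J : 'M[R]_n) (D M : I -> 'M[R]_n) :
  (forall i, Dm i -> 0 <= r i <= 1) -> (forall i, Dm i -> `|e i| <= 1) ->
  G0 *m J *m G0 = G0 ->
  bigOh Dm r 1 D -> bigOh Dm r 1 M ->
  bigOh Dm r 2 (fun i => M i *m G0 + D i *m J *m G0) ->
  bigOh Dm r 2 (fun i => congr_remainder (e i) G0 (D i) J (M i)).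
Proof.
move=> r01 e1 G0JG0 D1 M1 E2.
have cst X : bigOh Dm r 0 (fun=> X : 'M[R]_n) by exact: bigOh_cst.
have w1 X : bigOh Dm r 1 X -> bigOh Dm r 0 (X : I -> 'M[R]_n).
  exact: bigOh_weak.
have MT : bigOh Dm r 1 (fun i => (M i)^T) by exact: bigOhT.
have W1 : bigOh Dm r 1 (fun i => (G0 + D i) *m J *m (G0 + D i) - (G0 + D i)).
  apply: (@bigOh_ext _ _ _ _ _ _ _ _
    (fun i => D i *m J *m G0 + G0 *m J *m D i + D i *m J *m D i - D i)).
    move=> i _; rewrite !mulmxDl !mulmxDr G0JG0.
    by apply/matrixP => a b; rewrite !mxE; ring.
  apply: bigOhB => //; apply: bigOhD; first apply: bigOhD.
  - by apply: (bigOhM r01 (j := 1) (k := 0)) => //; apply: (bigOhM r01 (j := 1) (k := 0)).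
  - by apply: (bigOhM r01 (j := 0) (k := 1)).
  - by apply: (bigOhM r01 (j := 0) (k := 1)) => //; apply: (bigOhM r01 (j := 1) (k := 0)).
rewrite /congr_remainder; apply: bigOhD; first apply: bigOhD; first apply: bigOhD;
  first apply: bigOhD.
- apply: (bigOhM r01 (j := 1) (k := 1)) => //.
  by apply: (bigOhM r01 (j := 1) (k := 0)).
- by apply: bigOhD => //; apply: bigOhT.
- by apply: bigOhD; apply: (bigOhM r01 (j := 1) (k := 1)).
- by apply: bigOhZ => //; apply: bigOhD; apply: (bigOhM r01 (j := 1) (k := 1)).
- apply: bigOhZ => //; apply: (bigOhM r01 (j := 1) (k := 1)) => //.
  apply: (bigOhM r01 (j := 1) (k := 0)) => //.
  apply: bigOhD; first by apply: bigOhD => //; exact: w1.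
  by apply: bigOhZ => //; exact: w1.
Qed.

Lemma unitmx_near_1 n (X : 'M[R]_n) : fnorm X <= 2^-1 ->
  1%:M + X \in unitmx /\
  fnorm (invmx (1%:M + X)) <= 2 * fnorm (1%:M : 'M[R]_n).
Proof.
move=> X12; have unitX : 1%:M + X \in unitmx.
  apply: row_inj_unitmx => v; rewrite mulmxDr mulmx1 => /eqP.
  rewrite addr_eq0 => /eqP vE; apply: fnorm_eq0.
  have : fnorm v <= fnorm v * 2^-1.
    by rewrite {1}vE fnormN (le_trans (fnormM _ _)) // ler_wpM2l.
  have := fnorm_ge0 v; lra.
split=> //; set V := invmx _.
have VE : V = 1%:M - V *m X.
  by apply/eqP; rewrite -subr_eq0 opprB addrA -{1}[V]mulmx1 -mulmxDr mulVmx // subrr.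
have : fnorm V <= fnorm (1%:M : 'M[R]_n) + fnorm V * 2^-1.
  rewrite {1}VE (le_trans (fnormB _ _)) // lerD //.
  by rewrite (le_trans (fnormM _ _)) // ler_wpM2l.
lra.
Qed.

End Congruence.

Section ComplementaryPath.
Variables (R : realType) (I : Type) (D : set I) (r e : I -> R).
Hypothesis r01 : forall i, D i -> 0 <= r i <= 1.
Hypothesis e12 : forall i, D i -> 0 <= e i <= 2^-1.

(* The directions (L0 - L, S0 - S) are tangent, up to second order, to the set of
   complementary pairs at (L, S).  Interpolating L with L J L, and S with S T S,
   where J and T are pseudo-inverses of L0 and S0, preserves complementarity
   exactly; the congruence by 1 + eK then corrects the first order terms. *)
Lemma complementary_path n (L0 S0 : 'M[R]_n) (dL dS : I -> 'M[R]_n) :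
  psd L0 -> psd S0 -> L0 *m S0 = 0 ->
  (forall i, D i -> [/\ psd (L0 + dL i), psd (S0 + dS i)
                      & (L0 + dL i) *m (S0 + dS i) = 0]) ->
  bigOh D r 1 dL -> bigOh D r 1 dS ->
  exists rho (RL RS : I -> 'M[R]_n), let D' := D `&` [set i | r i <= rho] in
  [/\ 0 < rho, bigOh D' r 2 RL, bigOh D' r 2 RS & forall i, D' i ->
      let Lh := L0 + dL i - e i *: dL i + e i *: RL i in
      let Sh := S0 + dS i - e i *: dS i + e i *: RS i in
      [/\ psd Lh, psd Sh & Lh *m Sh = 0]].
Proof.
move=> L0psd S0psd L0S0 path dL1 dS1.
have [J [Jpsd L0JL0 JL0]] := psd_pinv L0psd.
have [T [Tpsd S0TS0 TS0]] := psd_pinv S0psd.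
have [[L0sym S0sym] [Jsym Tsym]] := ((psd_sym L0psd, psd_sym S0psd), (psd_sym Jpsd, psd_sym Tpsd)).
have dLsym i : D i -> (dL i)^T = dL i.
  move=> /path[/psd_sym + _ _]; rewrite linearD /= L0sym; exact: addrI.
have dSsym i : D i -> (dS i)^T = dS i.
  move=> /path[_ /psd_sym + _]; rewrite linearD /= S0sym; exact: addrI.
pose P := L0 *m J.
(* The second term cancels the cross term of [L]. The first is invisible there, since [1 - P] kills
   [L0], and is dictated by the cross term of [S], on which the inverse transpose acts. *)
pose K i := T *m dS i *m (1%:M - P) - dL i *m J.
have KO : bigOh D r 1 K.
  apply: bigOhB; last first.
    by apply: (bigOhM r01 (j := 1) (k := 0)) => //; exact: bigOh_cst.
  apply: (bigOhM r01 (j := 1) (k := 0)) => //; last exact: bigOh_cst.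
  by apply: (bigOhM r01 (j := 0) (k := 1)) => //; exact: bigOh_cst.
have [CK CK0 KC] := KO.
have CK1 : 0 < CK + 1 by rewrite ltr_wpDl.
(* With [e <= 1/2] this keeps [e K] of norm at most [1/2], so [1 + e K] has a bounded inverse. *)
pose rho := (CK + 1)^-1.
have rho0 : 0 < rho by rewrite invr_gt0.
pose D' := D `&` [set i | r i <= rho].
have D'D : D' `<=` D by move=> i [].
have r01' i : D' i -> 0 <= r i <= 1 by move/D'D; exact: r01.
have e1' i : D' i -> `|e i| <= 1.
  by move=> /D'D/e12/andP[? ?]; rewrite ger0_norm //; lra.
have eK12 i : D' i -> fnorm (e i *: K i) <= 2^-1.
  move=> D'i; have [Di ri] := D'i; have /andP[e0 e2] := e12 Di.
  rewrite fnormZ ger0_norm // -[leRHS]mulr1 ler_pM //.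
  apply: le_trans (KC i Di) _; rewrite expr1.
  apply: (@le_trans _ _ (CK * rho)); first by rewrite ler_wpM2l.
  by rewrite ler_pdivrMr // mul1r lerDl.
pose V i := invmx (1%:M + e i *: K i).
have VC i : D' i -> V i *m (1%:M + e i *: K i) = 1%:M.
  by move=> D'i; rewrite mulVmx //; have [] := unitmx_near_1 (eK12 i D'i).
have VO : bigOh D' r 0 V.
  exists (2 * fnorm (1%:M : 'M[R]_n)) => [|i D'i]; first exact: mulr_ge0.
  by rewrite mulr1; have [] := unitmx_near_1 (eK12 i D'i).
have VE i : D' i -> V i = 1%:M - e i *: (V i *m K i).
  by move/VC; rewrite mulmxDr mulmx1 -scalemxAr => <-; rewrite addrK.
have KO' : bigOh D' r 1 K by exact: bigOh_sub KO.
have dLO' : bigOh D' r 1 dL by exact: bigOh_sub dL1.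
have dSO' : bigOh D' r 1 dS by exact: bigOh_sub dS1.
have cst (X : 'M[R]_n) : bigOh D' r 0 (fun=> X) by exact: bigOh_cst.
(* [1 + e N] is the inverse transpose of [1 + e K]: the two congruences cancel in the product of the
   new pair. *)
pose N i := - (V i *m K i)^T.
have NO : bigOh D' r 1 N.
  by apply: bigOhN; apply: bigOhT; apply: (bigOhM r01' (j := 0) (k := 1)).
have EL : bigOh D' r 2 (fun i => K i *m L0 + dL i *m J *m L0).
  apply: (@bigOh_ext _ _ _ _ _ _ _ _ (fun=> 0)) => [i _|]; last first.
    by exists 0 => // i _; rewrite fnorm0 mul0r.
  by rewrite mulmxBl -(mulmxA _ (1%:M - P)) mulmxBl mul1mx L0JL0 subrr mulmx0 sub0r addNr.
have ES : bigOh D' r 2 (fun i => N i *m S0 + dS i *m T *m S0).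
  apply: (@bigOh_ext _ _ _ _ _ _ _ _
    (fun i => e i *: ((V i *m K i *m K i)^T *m S0) - J *m dL i *m dS i *m T *m S0)).
    move=> i D'i; have Di := D'D _ D'i.
    have VK : V i *m K i = K i - e i *: (V i *m K i *m K i).
      by rewrite {1}VE // mulmxBl mul1mx -scalemxAl.
    have KT : (K i)^T = (1%:M - P) *m dS i *m T - J *m dL i.
      rewrite linearB /= !trmx_mul Jsym dLsym // Tsym dSsym //.
      by rewrite linearB /= trmx1 /P trmx_mul L0sym Jsym JL0 mulmxA.
    (* The product of the moved pair vanishes, so its first-order part is minus the second-order
       term. *)
    have cross : J *m dL i *m S0 + P *m dS i = - (J *m dL i *m dS i).
      have [_ _] := path i Di; rewrite mulmxDl !mulmxDr L0S0 add0r.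
      move/(congr1 (mulmx J)); rewrite mulmx0 !mulmxDr !mulmxA JL0 -/P.
      by move=> /eqP; rewrite addrCA addrA addr_eq0 => /eqP <-; rewrite addrC.
    have cross' : J *m dL i *m S0 + P *m dS i *m T *m S0
        = - (J *m dL i *m dS i *m T *m S0).
      have := congr1 (fun X => X *m T *m S0) cross; rewrite /= !mulmxDl !mulNmx.
      by rewrite -(mulmxA _ S0) -(mulmxA _ _ S0) S0TS0 -!mulmxA => <-; rewrite !mulmxA.
    have NE : N i = e i *: (V i *m K i *m K i)^T - ((1%:M - P) *m dS i *m T - J *m dL i).
      by rewrite /N {1}VK [(_ - _)^T]linearB /= [(e i *: _)^T]linearZ /= KT opprB.
    rewrite NE 2!mulmxBl -scalemxAl -cross'.
    rewrite !mulmxBl mul1mx.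
    move: (dS i *m T *m S0) (P *m dS i *m T *m S0) (J *m dL i *m S0) => X1 X2 X3.
    by apply/matrixP => a c; rewrite !mxE; ring.
  apply: bigOhB.
    apply: bigOhZ => //; apply: (bigOhM r01' (j := 2) (k := 0)) => //.
    apply: bigOhT; apply: (bigOhM r01' (j := 1) (k := 1)) => //.
    by apply: (bigOhM r01' (j := 0) (k := 1)).
  apply: (bigOhM r01' (j := 2) (k := 0)) => //.
  apply: (bigOhM r01' (j := 2) (k := 0)) => //.
  apply: (bigOhM r01' (j := 1) (k := 1)) => //.
  by apply: (bigOhM r01' (j := 0) (k := 1)).
exists rho, (fun i => congr_remainder (e i) L0 (dL i) J (K i)),
  (fun i => congr_remainder (e i) S0 (dS i) T (N i)); split=> //.
- exact: bigOh_congr_remainder.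
- exact: bigOh_congr_remainder.
move=> i D'i; have Di := D'D _ D'i; have [Lpsd Spsd LS] := path i Di.
have e01 : 0 <= e i <= 1 by have := e12 Di; lra.
rewrite /= -!congr_expansion ?dLsym ?dSsym //.
split; [by apply: psd_congr; apply: psd_interp|by apply: psd_congr; apply: psd_interp|].
have NV : 1%:M + e i *: N i = (V i)^T.
  by rewrite {1}VE // linearB /= linearZ /= trmx1 /N scalerN.
rewrite NV trmxK; set L := L0 + dL i in LS *; set S := S0 + dS i in LS *.
(* [L] factors out on the right and [S] on the left, so that [L *m S] appears in the middle. *)
have -> : (1 - e i) *: L + e i *: (L *m J *m L) = ((1 - e i)%:M + e i *: (L *m J)) *m L.
  by rewrite [RHS]mulmxDl mul_scalar_mx -scalemxAl.
have -> : (1 - e i) *: S + e i *: (S *m T *m S) = S *m ((1 - e i)%:M + e i *: (T *m S)).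
  by rewrite [RHS]mulmxDr mul_mx_scalar -scalemxAr mulmxA.
rewrite -!mulmxA (mulmxA _^T) -trmx_mul VC // trmx1 mul1mx (mulmxA L) LS.
by rewrite !(mul0mx, mulmx0).
Qed.

End ComplementaryPath.

(** * Scaling of the solution map *)

Section SolutionScaling.
Variables (R : realType) (m n p : nat).
Variables (A : {linear 'M[R]_(m, n) -> 'cV[R]_p}) (b : 'cV[R]_p).
Variables (l0 : R) (y : R -> 'cV[R]_p) (L : R -> 'M[R]_n).
Hypotheses (l0_gt0 : 0 < l0) (kktP : forall l, 0 < l -> kkt A b l (y l) (L l)).
Hypothesis nondeg : constraint_nondegenerate A l0 (y l0).

(** The solution at [l0] serves as approximate solution at [l0 + h]: the equation for [y] holds
    exactly, and the slack is off by a scalar matrix of size [O(h)]. *)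
Lemma solution_calm : exists2 C, 0 <= C & forall h, `|h| <= Num.min 1 (l0 / 2) ->
  fnorm (y (l0 + h) - y l0) <= C * `|h| /\ fnorm (L (l0 + h) - L l0) <= C * `|h|.
Proof.
have [C [d [C0 d0 stab]]] := kkt_stability b l0_gt0 nondeg.
have [L0psd S0psd LS0 y0E] := kktP l0_gt0.
pose C' := C * ((2 * l0 + 1) * fnorm (1%:M : 'M[R]_n)).
have l1 : 0 <= 2 * l0 + 1 by have := l0_gt0; lra.
exists C' => [|h]; first by rewrite !mulr_ge0.
rewrite le_min => /andP[h1]; rewrite ler_norml => /andP[hl hr].
have hl0 : l0 / 2 <= l0 + h by lra.
have hp : 0 < l0 + h by have := l0_gt0; lra.
have dist0 k q (X : 'M[R]_(k, q)) : fnorm (X - X) <= d by rewrite subrr fnorm0 ltW.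
have := stab _ _ _ (y l0) (L l0) _ hl0 (kktP hp) L0psd S0psd LS0 (dist0 _ _ _) (dist0 _ _ _).
have -> : y l0 - b + A (adjoint A (y l0) *m L l0) = 0.
  by apply/eqP; rewrite addrAC subr_eq0 {1}y0E subrK.
rewrite fnorm0 add0r.
have -> : slack l0 (adjoint A (y l0)) - slack (l0 + h) (adjoint A (y l0))
    = (- (h * (2 * l0 + h))) *: 1%:M.
  by apply/matrixP => i j; rewrite /slack !mxE; ring.
rewrite fnormZ normrN normrM.
have eh : C * (`|h| * `|2 * l0 + h| * fnorm (1%:M : 'M[R]_n)) <= C' * `|h|.
  have hle : `|2 * l0 + h| <= 2 * l0 + 1.
    by rewrite ger0_norm; have := ler_norm h; have := l0_gt0; lra.
  have -> : C' * `|h| = C * (`|h| * (2 * l0 + 1) * fnorm (1%:M : 'M[R]_n)).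
    by rewrite /C'; ring.
  by rewrite ler_wpM2l // ler_wpM2r // ler_wpM2l.
by case=> hy hL; split; [apply: le_trans hy _|apply: le_trans hL _].
Qed.

(** The optimality system is quadratic, so interpolating two solutions misses a product such as
    [Z *m L] by [e (e - 1)] times a product of increments. Both residuals are thus exactly [e] times
    second-order quantities, and stability passes this on to [y]. *)
Lemma solution_scaling : exists C rho, [/\ 0 <= C, 0 < rho & forall h e,
  `|h| <= rho -> 0 <= e <= 2^-1 ->
  fnorm (y (l0 + (1 - e) * h) - (y (l0 + h) - e *: (y (l0 + h) - y l0)))
    <= C * e * `|h| ^+ 2].
Proof.
have [C1 C10 calm] := solution_calm.
have [Cs [d [Cs0 d0 stab]]] := kkt_stability b l0_gt0 nondeg.
have [a a0 [_ A'a]] := adjoint_bounded A.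
have [L0psd S0psd LS0 y0E] := kktP l0_gt0.
pose rho1 : R := Num.min 1 (l0 / 2).
have rho1p : 0 < rho1 by rewrite lt_min ltr01 divr_gt0.
(* Indices are pairs [(h, e)]; the size [r] sees [h] only, which makes every bound uniform in
   [e]. *)
pose D : set (R * R) := [set i | `|i.1| <= rho1 /\ 0 <= i.2 <= 2^-1].
pose r (i : R * R) := `|i.1|; pose e (i : R * R) := i.2.
have r01 i : D i -> 0 <= r i <= 1.
  by move=> [+ _]; rewrite le_min /r normr_ge0 => /andP[->].
have e12 i : D i -> 0 <= e i <= 2^-1 by case.
have e1 i : D i -> `|e i| <= 1 by move=> /e12/andP[? ?]; rewrite ger0_norm //; lra.
have e1' i : D i -> `|e i - 1| <= 1.
  by move=> /e12/andP[? ?]; rewrite ler0_norm; lra.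
have pos i : D i -> l0 / 2 <= l0 + i.1.
  by move=> [+ _]; rewrite le_min => /andP[_]; rewrite ler_norml => /andP[+ _]; lra.
have pos' i : D i -> 0 < l0 + i.1 by move=> /pos; have := l0_gt0; lra.
pose Z l := adjoint A (y l); pose S l := slack l (Z l).
pose dy (i : R * R) := y (l0 + i.1) - y l0.
pose dL (i : R * R) := L (l0 + i.1) - L l0.
pose dZ (i : R * R) := Z (l0 + i.1) - Z l0.
pose dS (i : R * R) := S (l0 + i.1) - S l0.
have dyO : bigOh D r 1 dy by exists C1 => // i [/calm[]].
have dLO : bigOh D r 1 dL by exists C1 => // i [/calm[]].
have dZO : bigOh D r 1 dZ.
  exists (a * C1) => [|i Di]; first exact: mulr_ge0.
  rewrite /dZ /Z -adjointB; apply: le_trans (A'a _) _.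
  by rewrite -mulrA ler_wpM2l //; case: Di => /calm[].
have cst k q (X : 'M[R]_(k, q)) : bigOh D r 0 (fun=> X) by exact: bigOh_cst.
have ZO : bigOh D r 0 (fun i => Z (l0 + i.1)).
  apply: (@bigOh_ext _ _ _ _ _ _ _ _ (fun i => dZ i + Z l0)) => [i _|].
    by rewrite /dZ subrK.
  by apply: bigOhD => //; exact: bigOh_weak dZO.
have dSO : bigOh D r 1 dS.
  apply: (@bigOh_ext _ _ _ _ _ _ _ _ (fun i => (i.1 * (2 * l0 + i.1)) *: 1%:M
     - ((dZ i)^T *m Z (l0 + i.1) + (Z l0)^T *m dZ i))) => [i _|].
    rewrite /dS /S /slack [(dZ i)^T]linearB /= mulmxBl mulmxBr addrA subrK.
    by apply/matrixP => ? ?; rewrite !mxE; ring.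
  apply: bigOhB.
    exists ((2 * l0 + 1) * fnorm (1%:M : 'M[R]_n)) => [|i Di].
      by rewrite mulr_ge0 //; have := l0_gt0; lra.
    have hle : `|2 * l0 + i.1| <= 2 * l0 + 1.
      have := pos' i Di; have := r01 i Di; rewrite /r => /andP[_ ri] li.
      by rewrite ger0_norm; have := ler_norm i.1; have := l0_gt0; lra.
    rewrite fnormZ normrM expr1 -/(r i) [leRHS]mulrC mulrA ler_wpM2r //.
    by rewrite ler_wpM2l //; case/andP: (r01 i Di).
  apply: bigOhD.
    by apply: (bigOhM r01 (j := 1) (k := 0)) => //; exact: bigOhT.
  by apply: (bigOhM r01 (j := 0) (k := 1)) => //; exact: bigOhT.
have path i : D i -> [/\ psd (L l0 + dL i), psd (S l0 + dS i)
                       & (L l0 + dL i) *m (S l0 + dS i) = 0].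
  have -> : L l0 + dL i = L (l0 + i.1) by rewrite addrC subrK.
  have -> : S l0 + dS i = S (l0 + i.1) by rewrite addrC subrK.
  by move=> /pos'/kktP[].
have S0psd' : psd (S l0) := S0psd.
have LS0' : L l0 *m S l0 = 0 := LS0.
have := complementary_path r01 e12 L0psd S0psd' LS0' path dLO dSO.
move=> [rho2 [RL [RS [rho2p RLO RSO hat]]]].
set D2 := D `&` _ in RLO RSO hat.
have D2D : D2 `<=` D by move=> i [].
have r01' i : D2 i -> 0 <= r i <= 1 by move/D2D; exact: r01.
pose yh i := y (l0 + i.1) - e i *: dy i.
pose Zh i := Z (l0 + i.1) - e i *: dZ i.
have ZhE i : adjoint A (yh i) = Zh i.
  by rewrite /yh adjointB adjointZ /dy adjointB.
pose Lh i := L l0 + dL i - e i *: dL i + e i *: RL i.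
pose Sh i := S l0 + dS i - e i *: dS i + e i *: RS i.
pose l' (i : R * R) := l0 + (1 - e i) * i.1.
pose F1 i := A ((e i - 1) *: (dZ i *m dL i) + Zh i *m RL i).
pose F2 i := RS i + (e i - 1) *: ((dZ i)^T *m dZ i) - (e i - 1) *: (i.1 ^+ 2 *: 1%:M).
have F1E i : D2 i -> yh i - b + A (adjoint A (yh i) *m Lh i) = e i *: F1 i.
  move=> /D2D/pos'/kktP[_ _ _ yE].
  have -> : yh i - b = - A ((1 - e i) *: (Z (l0 + i.1) *m L (l0 + i.1))
                            + e i *: (Z l0 *m L l0)).
    rewrite linearD !linearZ /= /yh /dy.
    have -> : A (Z l0 *m L l0) = b - y l0 by rewrite [in RHS]y0E subKr.
    have -> : A (Z (l0 + i.1) *m L (l0 + i.1)) = b - y (l0 + i.1).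
      by rewrite [in RHS]yE subKr.
    by apply/matrixP => ? ?; rewrite !mxE; ring.
  rewrite ZhE /F1 -[- A _]linearN -[A _ + A _]linearD -[e i *: A _]linearZ /=; congr (A _).
  rewrite /Lh /Zh /dL /dZ addrC [L l0 + _]addrC subrK.
  rewrite !(mulmxBl, mulmxBr, mulmxDl, mulmxDr) -!(scalemxAl, scalemxAr).
  rewrite ?(mulmxBl, mulmxBr, mulmxDl, mulmxDr) -?(scalemxAl, scalemxAr).
  by apply/matrixP => ? ?; rewrite !mxE; ring.
have F2E i : Sh i - slack (l' i) (adjoint A (yh i)) = e i *: F2 i.
  rewrite ZhE /F2 /Sh /dS /Zh /dZ addrC [S l0 + _]addrC subrK /S /slack /l'.
  rewrite ![(_ - _)^T]linearB /= [(e i *: _)^T]linearZ /= [(Z _ - _)^T]linearB /=.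
  rewrite !(mulmxBl, mulmxBr) -?(scalemxAl, scalemxAr).
  rewrite ?(mulmxBl, mulmxBr) -?(scalemxAl, scalemxAr).
  by apply/matrixP => ? ?; rewrite !mxE; ring.
have dZO2 : bigOh D2 r 1 dZ by exact: bigOh_sub dZO.
have dLO2 : bigOh D2 r 1 dL by exact: bigOh_sub dLO.
have dSO2 : bigOh D2 r 1 dS by exact: bigOh_sub dSO.
have F1O : bigOh D2 r 2 F1.
  apply: bigOh_linear; apply: bigOhD.
    apply: bigOhZ => [i /D2D/e1'//|].
    by apply: (bigOhM r01' (j := 1) (k := 1)).
  apply: (bigOhM r01' (j := 0) (k := 2)) => //.
  apply: bigOhB; first by apply: bigOh_sub ZO.
  by apply: bigOhZ => [i /D2D/e1//|]; exact: bigOh_weak dZO2.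
have F2O : bigOh D2 r 2 F2.
  apply: bigOhB; first apply: bigOhD => //.
    apply: bigOhZ => [i /D2D/e1'//|].
    by apply: (bigOhM r01' (j := 1) (k := 1)) => //; exact: bigOhT.
  apply: bigOhZ => [i /D2D/e1'//|].
  exists (fnorm (1%:M : 'M[R]_n)) => // i _.
  by rewrite fnormZ normrX mulrC.
have [c1 c10 F1c] := F1O; have [c2 c20 F2c] := F2O.
have ShO : bigOh D2 r 1 (fun i => Sh i - S l0).
  apply: (@bigOh_ext _ _ _ _ _ _ _ _ (fun i => dS i - e i *: dS i + e i *: RS i)).
    by move=> i _; apply/matrixP => ? ?; rewrite /Sh !mxE; ring.
  apply: bigOhD; first by apply: bigOhB => //; apply: bigOhZ => [i /D2D/e1//|].
  by apply: bigOhZ => [i /D2D/e1//|]; exact: bigOh_weak RSO.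
have [c3 c30 Shc] := ShO.
(* The last term keeps [yh] and [Sh] within the radius [d] where stability applies. *)
pose rho := Num.min (Num.min rho1 rho2) (d / (C1 + c3 + 1)).
have rhop : 0 < rho.
  by rewrite 2!lt_min rho1p rho2p divr_gt0 //; lra.
exists (Cs * (c1 + c2)), rho; split=> // [|h t hrho t12].
  by rewrite mulr_ge0 // addr_ge0.
move: hrho; rewrite 2!le_min => /andP[/andP[h1 h2] hd].
pose i := (h, t); have Di : D i by split.
have D2i : D2 i by split.
have t01 : 0 <= 1 - t <= 1 by move: t12; lra.
have l'2 : l0 / 2 <= l' i.
  have := pos i Di; rewrite /l' /e /=; have := l0_gt0; nra.
have l'p : 0 < l' i by have := l0_gt0; lra.
have [Lhpsd Shpsd LhSh] := hat i D2i.
have hd' : (C1 + c3 + 1) * `|h| <= d by rewrite mulrC -ler_pdivlMr //; lra.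
have close1 : fnorm (Sh i - S l0) <= d.
  apply: le_trans (Shc i D2i) _; apply: le_trans hd'.
  by rewrite expr1 /r ler_wpM2r //; lra.
have close2 : fnorm (yh i - y l0) <= d.
  have -> : yh i - y l0 = (1 - t) *: dy i.
    by apply/matrixP => ? ?; rewrite /yh /dy /e !mxE /=; ring.
  rewrite fnormZ ger0_norm; last by case/andP: t01.
  apply: le_trans hd'; rewrite -[leRHS]mul1r ler_pM //; try by case/andP: t01.
  have [+ _] := calm h h1; move=> /le_trans; apply.
  by rewrite ler_wpM2r //; lra.
have [+ _] := stab _ _ _ (yh i) (Lh i) (Sh i) l'2 (kktP l'p) Lhpsd Shpsd LhSh close1 close2.
rewrite F1E // F2E !fnormZ => /le_trans; apply.
have t0 : 0 <= t by case/andP: t12.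
rewrite /e /= ger0_norm // -mulrDr -!mulrA ler_wpM2l // [leRHS]mulrCA ler_wpM2l //.
by rewrite mulrDl lerD ?F1c ?F2c.
Qed.

End SolutionScaling.

(** * A criterion for strong semismoothness *)

Section SemismoothCriterion.
Variables (R : realType) (U : set R) (f : R -> R) (x C rho : R).
Hypotheses (Uopen : open U) (Ux : U x) (C0 : 0 <= C) (rho0 : 0 < rho).
Hypothesis f_lipschitz : forall z, U z -> exists2 W, nbhs z W &
  exists K, forall s t, W s -> W t -> `|f s - f t| <= K * `|s - t|.
Hypothesis f_scaling : forall h e, `|h| <= rho -> 0 <= e <= 2^-1 ->
  `|f (x + (1 - e) * h) - ((1 - e) * f (x + h) + e * f x)| <= C * e * `|h| ^+ 2.

(** The difference quotient with step [- e h] points back to [x], and the scaling hypothesis divided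
    by [e] controls it as [e] tends to 0. *)
Lemma derivative_scaling h : `|h| <= rho -> derivable f (x + h) 1 ->
  `|f (x + h) - f x - derive1 f (x + h) * h| <= C * `|h| ^+ 2.
Proof.
move=> hrho df; have [->|h0] := eqVneq h 0.
  by rewrite !mulr0 addr0 subrr subr0 normr0 mulr_ge0 // sqr_ge0.
set V := derive1 f (x + h).
have hp : 0 < `|h| by rewrite normr_gt0.
apply/ler_addgt0Pr => eta eta0.
have cvgV : s^-1 *: (f (s *: 1 + (x + h)) - f (x + h)) @[s --> 0^'] --> V.
  by rewrite /V derive1E; exact: df.
move/cvgrPdist_le: cvgV => /(_ _ (divr_gt0 eta0 hp)).
rewrite near_withinE => /nbhs_norm0P[d /= d0 hd].
pose e := Num.min 2^-1 (d / 2 / `|h|).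
have e0 : 0 < e by rewrite lt_min invr_gt0 ltr0n /= !divr_gt0.
have e2 : e <= 2^-1 by rewrite ge_min lexx.
have eh : `|e * h| < d.
  rewrite normrM gtr0_norm //; apply: (@le_lt_trans _ _ (d / 2)); last by lra.
  by rewrite -ler_pdivlMr // ge_min lexx orbT.
have := hd (- (e * h)); rewrite /= normrN => /(_ eh).
rewrite oppr_eq0 mulf_eq0 (gt_eqF e0) (negbTE h0) => /(_ isT).
rewrite scaler1 -[_ *: _]/(_ * _).
have -> : - (e * h) + (x + h) = x + (1 - e) * h by ring.
have := f_scaling hrho; move=> /(_ e); rewrite (ltW e0) e2 => /(_ isT).
set F := f (x + h); set F' := f _; set F0 := f x => hs hV.
have h1 : e * (F - F0 - V * h) =
   (F' - ((1 - e) * F + e * F0)) + (- (e * h)) * (V - (- (e * h))^-1 * (F' - F)).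
  have mv : - (e * h) * ((- (e * h))^-1 * (F' - F)) = F' - F.
    by rewrite mulrA divff ?mul1r // oppr_eq0 mulf_neq0 // gt_eqF.
  rewrite [- (e * h) * (V - _)]mulrBr mv; ring.
rewrite -(ler_pM2l e0) -{1}(gtr0_norm e0) -normrM h1.
apply: le_trans (ler_normD _ _) _; rewrite [leRHS]mulrDr; apply: lerD.
  by have -> : e * (C * `|h| ^+ 2) = C * e * `|h| ^+ 2 by ring.
rewrite normrM normrN normrM gtr0_norm // -mulrA ler_pM2l //.
by rewrite mulrC -ler_pdivlMr.
Qed.

(** The bound of [derivative_scaling] passes to limits of derivatives by continuity of [f], and to
    their convex hull because it is convex in [V]. *)
Lemma scaling_strongly_G_semismooth : strongly_G_semismooth U f x.
Proof.
exists C; have /nbhs_ballP[d /= d0 dU] := open_nbhs_nbhs (conj Uopen Ux).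
near=> h; have hrho : `|h| < rho.
  by near: h; apply: dnbhs0_lt.
have hd : `|h| < d by near: h; apply: dnbhs0_lt.
have Uxh : U (x + h).
  by apply: dU; rewrite /ball /= opprD addNKr normrN.
pose S := [set V : R^o | `|f (x + h) - f x - V * h| <= C * `|h| ^+ 2].
suff : clarke_jacobian U f (x + h) `<=` S by move=> + V; apply.
apply: smallest_sub => [|V [u [uU ux uV]]].
  apply/convex_setW => a b; rewrite !inE /S /= => Sa Sb t t0 t1.
  apply/mem_set; rewrite /S /= -[conv _ _ _]/(t%:num * a + (1 - t%:num) * b).
  have -> : f (x + h) - f x - (t%:num * a + (1 - t%:num) * b) * h
      = t%:num * (f (x + h) - f x - a * h)
        + (1 - t%:num) * (f (x + h) - f x - b * h) by ring.
  have t1' : 0 <= 1 - t%:num by rewrite subr_ge0 ltW.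
  apply: le_trans (ler_normD _ _) _.
  rewrite !normrM (ger0_norm (ltW t0)) (ger0_norm t1').
  have := ler_wpM2l (ltW t0) Sa; have := ler_wpM2l t1' Sb; lra.
rewrite /S /=.
have fc : f z @[z --> x + h] --> f (x + h).
  have [W Wx [K fK]] := f_lipschitz Uxh.
  apply/cvgrPdist_le => eps eps0; near=> z.
  apply: le_trans (fK _ _ (nbhs_singleton Wx) _) _; first by near: z.
  apply: (@le_trans _ _ ((`|K| + 1) * `|x + h - z|)).
    by rewrite ler_wpM2r // (le_trans (ler_norm _)) // lerDl.
  rewrite mulrC -ler_pdivlMr ?ltr_wpDl //.
  by near: z; apply: cvgr_dist_le; [exact: cvg_id|rewrite divr_gt0 // ltr_wpDl].
have fu : f (u k) @[k --> \oo] --> f (x + h) by apply: cvg_comp ux fc.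
have hu : u k - x @[k --> \oo] --> h.
  have : u k - x @[k --> \oo] --> x + h - x by apply: cvgB ux _; exact: cvg_cst.
  by rewrite (addrC x) addrK.
have lhs : `|f (u k) - f x - derive1 f (u k) * (u k - x)| @[k --> \oo]
    --> `|f (x + h) - f x - V * h|.
  apply: cvg_norm; apply: cvgB; last exact: cvgM.
  by apply: cvgB fu _; exact: cvg_cst.
have rhs : C * `|u k - x| ^+ 2 @[k --> \oo] --> C * `|h| ^+ 2.
  apply: cvgM; first exact: cvg_cst.
  by rewrite expr2; under eq_fun do rewrite expr2; apply: cvgM; exact: cvg_norm.
apply: ler_cvg_to lhs rhs _; near=> k.
have [_ duk] := uU k.
have ukE : u k = x + (u k - x) by rewrite addrC subrK.
rewrite {1 2}ukE; apply: derivative_scaling; last by rewrite -ukE.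
apply/ltW; near: k; exact: (cvgr_norm_lt _ hu).
Unshelve. all: by end_near. Qed.

(** Taking [e <= 1/2] compares [q] at points within a factor 2, at cost [2 C (h - h')], the 2 coming
    from [1 - e >= 1/2]. Under repeated halving these costs telescope, so [q] is Lipschitz on the
    whole interval. *)
Lemma quotient_limit (q : R -> R) : (forall h e, 0 < h <= rho -> 0 <= e <= 2^-1 ->
    `|(1 - e) * (q ((1 - e) * h) - q h)| <= C * e * h) ->
  exists l, forall h, 0 < h <= rho -> `|q h - l| <= 2 * C * h.
Proof.
move=> qH.
have q_half h h' : 0 < h <= rho -> h / 2 <= h' <= h -> `|q h' - q h| <= 2 * C * (h - h').
  move=> /andP[h0 hr] /andP[h2 hh]; pose e := (h - h') / h.
  have eh : e * h = h - h' by rewrite divfK ?gt_eqF.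
  have e0 : 0 <= e by rewrite divr_ge0 ?subr_ge0 // ltW.
  have e2 : e <= 2^-1 by rewrite ler_pdivrMr //; lra.
  have := qH h e; rewrite h0 hr e0 e2 => /(_ isT isT).
  have -> : (1 - e) * h = h' by rewrite mulrBl eh mul1r opprB addrC subrK.
  rewrite normrM -mulrA eh ger0_norm; last by lra.
  have : 0 <= `|q h' - q h| by [].
  move: `|_ - _| => Q Q0; nra.
have q_lip k h h' : 0 < h <= rho -> h / 2 ^+ k <= h' <= h ->
    `|q h' - q h| <= 2 * C * (h - h').
  elim: k h => [|k IHk] h.
    rewrite expr0 divr1 => _ hh; have -> : h' = h by apply/le_anti; rewrite andbC.
    by rewrite !subrr normr0 mulr0.
  move=> hr /andP[hk hh]; have [h2|h2] := leP (h / 2) h'; first by apply: q_half; rewrite ?h2.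
  move: (hr) => /andP[h0 hr'].
  have := IHk (h / 2); have -> : h / 2 / 2 ^+ k <= h' <= h / 2.
    by rewrite (ltW h2) andbT -mulrA -invfM -exprS.
  have -> : 0 < h / 2 <= rho by lra.
  move=> /(_ isT isT) q1; have := q_half h (h / 2) hr; have -> : h / 2 <= h / 2 <= h by lra.
  move=> /(_ isT) q2; rewrite -[q h'](subrK (q (h / 2))) -addrA.
  apply: le_trans (ler_normD _ _) _; lra.
have {}q_lip h h' : 0 < h' <= h -> h <= rho -> `|q h' - q h| <= 2 * C * (h - h').
  move=> /andP[h'0 hh] hr; have h0 : 0 < h by exact: lt_le_trans hh.
  have [k hk] : exists k, h / h' <= 2 ^+ k.
    have hh0 : 0 <= h / h' by rewrite divr_ge0 // ltW.
    exists (Num.bound (h / h')); apply: le_trans (ltW (archi_boundP hh0)) _.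
    by rewrite -natrX ler_nat ltnW // ltn_expl.
  apply: (q_lip k); rewrite ?h0 ?hr // hh andbT ler_pdivrMr ?exprn_gt0 //.
  by rewrite mulrC -ler_pdivrMr.
(* [q t + 2 C t] is nondecreasing, so its infimum is the limit of [q] at 0. *)
pose E := [set q t + 2 * C * t | t in [set t | 0 < t <= rho]].
have E_ge h t : 0 < h <= rho -> 0 < t <= rho -> q h - 2 * C * h <= q t + 2 * C * t.
  move=> /andP[h0 hr] /andP[t0 tr].
  have [th|/ltW ht] := leP t h.
    have := q_lip h t; rewrite t0 th => /(_ isT hr); rewrite ler_norml => /andP[+ _].
    have := mulr_ge0 C0 (ltW t0); have := mulr_ge0 C0 (ltW h0); lra.
  have := q_lip t h; rewrite h0 ht => /(_ isT tr); rewrite ler_norml => /andP[_ +].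
  have := mulr_ge0 C0 (ltW t0); have := mulr_ge0 C0 (ltW h0); lra.
have rr : 0 < rho <= rho by rewrite rho0 lexx.
have E0 : E !=set0 by exists (q rho + 2 * C * rho); exists rho.
exists (inf E) => h hr.
have : inf E <= q h + 2 * C * h.
  apply: ge_inf; last by exists h.
  by exists (q rho - 2 * C * rho) => _ [t tr <-]; exact: E_ge.
have : q h - 2 * C * h <= inf E by apply: lb_le_inf => // _ [t tr <-]; exact: E_ge.
by rewrite ler_norml; lra.
Qed.

(** The two one-sided slopes make up a positively homogeneous directional derivative, each with its
    own quadratic remainder. *)
Lemma scaling_calmly_B_differentiable : calmly_B_differentiable f x.
Proof.
have side s : `|s| = 1 -> exists l, forall h, 0 < h <= rho ->
    `|f (x + s * h) - f x - l * h| <= 2 * C * h ^+ 2.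
  move=> s1; have [|l lP] := @quotient_limit (fun h => (f (x + s * h) - f x) / h).
    move=> h e /andP[h0 hr] /[dup] he /andP[e0 e2].
    have nsh : `|s * h| = h by rewrite normrM s1 mul1r gtr0_norm.
    have := f_scaling (h := s * h); rewrite nsh => /(_ e hr he).
    have e1 : 1 - e != 0 by rewrite gt_eqF //; lra.
    have -> : s * ((1 - e) * h) = (1 - e) * (s * h) by ring.
    move: (f (x + (1 - e) * _)) => F' hs.
    have -> : (1 - e) * ((F' - f x) / ((1 - e) * h) - (f (x + s * h) - f x) / h)
        = (F' - ((1 - e) * f (x + s * h) + e * f x)) / h.
      by field; rewrite e1 gt_eqF.
    rewrite normrM normfV (gtr0_norm h0) ler_pdivrMr //.
    by have -> : C * e * h * h = C * e * h ^+ 2 by ring.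
  exists l => h hr; have := lP h hr; have /andP[h0 _] := hr.
  rewrite -(ler_pM2l h0) -{1}(gtr0_norm h0) -normrM.
  have -> : h * ((f (x + s * h) - f x) / h - l) = f (x + s * h) - f x - l * h.
    by field; rewrite gt_eqF.
  by move=> /le_trans; apply; rewrite expr2 mulrCA mulrA.
have [lp lpP] := side 1 (normr1 _); have [lm lmP] := side (-1) (normrN1 _).
pose D h := if 0 <= h then lp * h else lm * - h.
have DP h : `|h| <= rho -> `|f (x + h) - f x - D h| <= 2 * C * `|h| ^+ 2.
  rewrite /D; have [->|h0] := eqVneq h 0.
    by rewrite lexx mulr0 addr0 subrr subr0 normr0 expr0n mulr0.
  have [hp|hn] := leP 0 h => hr.
    have hp' : 0 < h by rewrite lt_def h0.
    have := lpP h; rewrite mul1r hp' -(ger0_norm hp) hr normr_id => /(_ isT).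
    by rewrite ger0_norm.
  have hn' : 0 < - h <= rho by rewrite oppr_gt0 hn -(ltr0_norm hn).
  by have := lmP (- h) hn'; rewrite mulN1r opprK (ltr0_norm hn).
have DZ t h : 0 < t -> D (t * h) = t * D h.
  by move=> t0; rewrite /D pmulr_rge0 //; case: ifP => _; ring.
exists D; split.
  move=> h; apply/cvgrPdist_le => eps eps0.
  have K0 : 0 < 2 * C * `|h| ^+ 2 + 1.
    by rewrite ltr_wpDl // mulr_ge0 ?sqr_ge0 // mulr_ge0.
  near=> t.
  have t0 : 0 < t by near: t; exact: nbhs_right_gt.
  have th : `|t * h| <= rho.
    rewrite normrM gtr0_norm // (@le_trans _ _ (t * (`|h| + 1))) //.
      by rewrite ler_pM2l // lerDl.
    rewrite -ler_pdivlMr ?ltr_wpDl //.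
    by near: t; apply: nbhs_right_le; rewrite divr_gt0 // ltr_wpDl.
  rewrite distrC -(ler_pM2l t0) -{1}(gtr0_norm t0) -normrM.
  have -> : t * ((f (x + t * h) - f x) / t - D h) = f (x + t * h) - f x - D (t * h).
    by rewrite DZ //; field; rewrite gt_eqF.
  apply: le_trans (DP _ th) _.
  have tK : t * (2 * C * `|h| ^+ 2 + 1) <= eps.
    rewrite -ler_pdivlMr //.
    by near: t; apply: nbhs_right_le; rewrite divr_gt0.
  rewrite normrM gtr0_norm // exprMn mulrCA expr2 -mulrA ler_pM2l //.
  by apply: le_trans tK; rewrite ler_pM2l // lerDl.
apply/eqO_exP; exists (2 * C + 1); first by rewrite ltr_wpDl // mulr_ge0.
have hr : \forall h \near (0 : R), `|h| <= rho by exact: nbhs0_le.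
apply: filterS hr => h hr; rewrite /= normrX normr_id; apply: le_trans (DP _ hr) _.
by rewrite ler_wpM2r ?sqr_ge0 // lerDl.
Unshelve. all: by end_near. Qed.

End SemismoothCriterion.

(** * Norms along a segment and the value function *)

Section FinalAssembly.
Variable R : realType.

(** Meant for [a = |u|], [c = |u0|], [q = |u - u0|] and [w] the norm of the interpolated vector.
    With [s] the interpolated norm, [s ^+ 2 - w ^+ 2] is at most [e * q ^+ 2]; dividing by
    [s + w >= c / 2] gives the constant. *)
Lemma interp_bound (a c q w e : R) : 0 <= e <= 1 -> 0 < c -> 0 <= a -> 0 <= w ->
  c - q <= a -> q <= c / 2 ->
  w ^+ 2 = (1 - e) * a ^+ 2 + e * c ^+ 2 - e * (1 - e) * q ^+ 2 ->
  w <= (1 - e) * a + e * c ->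
  `|w - ((1 - e) * a + e * c)| <= 2 * e * q ^+ 2 / c.
Proof.
move=> /andP[e0 e1] c0 a0 w0 ca qc wsq ws.
have [s sE] : {s | s = (1 - e) * a + e * c} by eexists.
rewrite -sE in ws *; rewrite distrC ger0_norm ?subr_ge0 // ler_pdivlMr //.
have sc : c / 2 <= s by rewrite sE; nra.
have sq : s ^+ 2 - w ^+ 2 <= e * q ^+ 2.
  have -> : s ^+ 2 - w ^+ 2 = e * (1 - e) * (q ^+ 2 - (a - c) ^+ 2).
    by rewrite wsq sE; ring.
  have q20 := sqr_ge0 q; have ac0 := sqr_ge0 (a - c).
  have ee : 0 <= e * e by rewrite mulr_ge0.
  have e1e : 0 <= e * (1 - e) by rewrite mulr_ge0 // subr_ge0.
  have := mulr_ge0 e1e ac0; have := mulr_ge0 ee q20; lra.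
have : (s - w) * (c / 2) <= (s - w) * (s + w).
  by rewrite ler_wpM2l ?subr_ge0 //; lra.
move: sq; rewrite subr_sqr; lra.
Qed.

Lemma fnorm_interp k (u u0 : 'cV[R]_k) e : 0 <= e <= 1 -> 0 < fnorm u0 ->
  fnorm (u - u0) <= fnorm u0 / 2 ->
  `|fnorm (u - e *: (u - u0)) - ((1 - e) * fnorm u + e * fnorm u0)|
    <= 2 * e * fnorm (u - u0) ^+ 2 / fnorm u0.
Proof.
move=> e01 u0p uu0; have /andP[e0 e1] := e01.
apply: interp_bound => //.
- by have := fnorm_dist u u0; rewrite ler_norml => /andP[h _]; lra.
- by rewrite !fnorm_sqr !inner_lin (innerC u0 u); ring.
have -> : u - e *: (u - u0) = (1 - e) *: u + e *: u0.
  by apply/matrixP => i j; rewrite !mxE; ring.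
apply: le_trans (fnormD _ _) _; rewrite !fnormZ.
by rewrite !ger0_norm // subr_ge0.
Qed.

Variables (m n p : nat) (A : {linear 'M[R]_(m, n) -> 'cV[R]_p}) (b : 'cV[R]_p).

Lemma value_function_locally_lipschitz (z : R) : 0 < z -> exists2 W, nbhs z W &
  exists K, forall s t, W s -> W t ->
    `|value_function A b s - value_function A b t| <= K * `|s - t|.
Proof.
move=> z0; exists [set s | z / 2 < s].
  by apply: lt_nbhsr; rewrite ltr_pdivrMr //; lra.
exists (2 * fnorm b / (z / 2)) => s t /= zs zt.
have z2 : 0 < z / 2 by rewrite divr_gt0.
have [s0 t0] : 0 < s /\ 0 < t by split; exact: lt_trans z2 _.
have [ys [Ls [kkts ->]]] := primal_dual_solution A b s0.
have [yt [Lt [kktt ->]]] := primal_dual_solution A b t0.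
apply: le_trans (fnorm_dist _ _) _; apply: le_trans (kkt_lipschitz s0 t0 kkts kktt) _.
rewrite ler_wpM2r // ler_wpM2l ?mulr_ge0 // lef_pV2 ?posrE // ltW //.
Qed.

End FinalAssembly.

Theorem proposition11 (R : realType) (m n p : nat)
    (A : {linear 'M[R]_(m, n) -> 'cV[R]_p}) (b : 'cV[R]_p)
    (hb : 0 < spectral_norm (adjoint A b))
    (lambda : R) (hlambda : 0 < lambda)
    (y : 'cV[R]_p) (hy : dual_solution A b lambda y)
    (hnd : constraint_nondegenerate A lambda y) :
  strongly_semismooth [set t : R | 0 < t] (value_function A b) lambda.
Proof.
have sol l : exists yL : 'cV[R]_p * 'M[R]_n,
    0 < l -> kkt A b l yL.1 yL.2 /\ value_function A b l = fnorm yL.1.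
  have [l0|l0] := ltP 0 l; last by exists (0, 0).
  by have [u [L h]] := primal_dual_solution A b l0; exists (u, L).
pose Y l := (sval (cid (sol l))).1; pose L l := (sval (cid (sol l))).2.
have solP l : 0 < l -> kkt A b l (Y l) (L l) /\ value_function A b l = fnorm (Y l).
  exact: svalP (cid (sol l)).
have kktP l : 0 < l -> kkt A b l (Y l) (L l) by move/solP => [].
(* Uniqueness, from the Lipschitz bound with equal parameters. *)
have Yy : Y lambda = y.
  have [L0 kkt0] := dual_solution_kkt hlambda hy.
  apply/eqP; rewrite -subr_eq0; apply/eqP/fnorm_eq0/eqP; rewrite eq_le fnorm_ge0 andbT.
  have := kkt_lipschitz hlambda hlambda (kktP _ hlambda) kkt0.
  by rewrite subrr normr0 mulr0.
rewrite -Yy in hnd.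
(* If the solution were 0, the optimality conditions would give [b = 0], against [hb]. *)
have y0 : 0 < fnorm (Y lambda).
  rewrite lt_def fnorm_ge0 andbT; apply: contraTneq hb => /fnorm_eq0 Y0.
  have [_ _ _] := kktP _ hlambda; rewrite Y0 adjoint0 mul0mx linear0 subr0 => <-.
  rewrite adjoint0 -leNgt; apply/spectral_normP => //.
  by rewrite mulmx0 subr0; apply: psdZ; [exact: sqr_ge0|exact: psd_scalar].
have [C1 C10 calm] := solution_calm hlambda kktP hnd.
have [C2 [rho2 [C20 rho20 scaling]]] := solution_scaling hlambda kktP hnd.
pose c := fnorm (Y lambda).
(* The last term keeps [Y (lambda + h)] within [c / 2] of [Y lambda], as [fnorm_interp] requires. *)
pose rho := Num.min (Num.min (Num.min 1 (lambda / 2)) rho2) (c / 2 / (C1 + 1)).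
have C11 : 0 < C1 + 1 by rewrite ltr_wpDl.
have rho0 : 0 < rho by rewrite !lt_min ltr01 rho20 !divr_gt0.
(* [C2] is the defect of the solution map; the other term is the curvature of the norm, with [C1]
   the calmness constant. *)
pose C := C2 + 2 * C1 ^+ 2 / c.
have C0 : 0 <= C.
  by rewrite addr_ge0 // divr_ge0 ?(ltW y0) // mulr_ge0 // sqr_ge0.
have f_scaling h e : `|h| <= rho -> 0 <= e <= 2^-1 ->
    `|value_function A b (lambda + (1 - e) * h)
      - ((1 - e) * value_function A b (lambda + h) + e * value_function A b lambda)|
    <= C * e * `|h| ^+ 2.
  rewrite le_min => /andP[]; rewrite le_min => /andP[h1 h2] h3 /[dup] he /andP[e0 e2].
  have := h1; rewrite le_min ler_norml => /andP[_ hl].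
  have hl' : - (lambda / 2) <= h by move: h1; rewrite le_min => /andP[_]; rewrite ler_norml => /andP[].
  have lh : 0 < lambda + h by lra.
  have leh : 0 < lambda + (1 - e) * h by nra.
  have [_ ->] := solP _ lh; have [_ ->] := solP _ leh; have [_ ->] := solP _ hlambda.
  have [cy _] := calm h h1; have sc := scaling h e h2 he.
  have yc : fnorm (Y (lambda + h) - Y lambda) <= fnorm (Y lambda) / 2.
    apply: le_trans cy _; move: h3; rewrite ler_pdivlMr // -/c => h3.
    by have := normr_ge0 h; lra.
  have e01 : 0 <= e <= 1 by lra.
  have := fnorm_interp e01 y0 yc; set u := Y (lambda + h) in sc yc cy *.
  set v := u - e *: (u - Y lambda) in sc * => interp.
  apply: le_trans (ler_distD (fnorm v) _ _) _.
  have -> : C * e * `|h| ^+ 2 = C2 * e * `|h| ^+ 2 + 2 * C1 ^+ 2 / c * (e * `|h| ^+ 2).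
    by rewrite /C; ring.
  apply: lerD; first exact: le_trans (fnorm_dist _ _) sc.
  apply: le_trans interp _.
  have -> : 2 * C1 ^+ 2 / c * (e * `|h| ^+ 2) = 2 * e * (C1 * `|h|) ^+ 2 / c by ring.
  rewrite ler_wpM2r ?invr_ge0 ?(ltW y0) // ler_wpM2l ?mulr_ge0 //.
  by rewrite lerXn2r ?nnegrE ?mulr_ge0.
have Uopen : open [set t : R | 0 < t] by exact: open_gt.
have lip z : [set t : R | 0 < t] z -> exists2 W, nbhs z W &
    exists K, forall s t, W s -> W t ->
      `|value_function A b s - value_function A b t| <= K * `|s - t|.
  exact: value_function_locally_lipschitz.
split=> //.
- move=> z /lip[W Wz [K fK]]; exists W => //.
  have Wprop : ProperFilter (globally (W `*` W)).
    apply: (@globally_properfilter _ _ (z, z)).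
    by split; exact: nbhs_singleton Wz.
  apply: klipschitzW => -[s t] [/= Ws Wt]; exact: fK.
- exact: (scaling_strongly_G_semismooth Uopen hlambda C0 rho0 lip f_scaling).
- exact: (scaling_calmly_B_differentiable C0 rho0 f_scaling).
Qed.
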